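(* The part of the Master Teapot inside the unit cylinder is not symmetrical with respect to reflection across the imaginary axis; that is, $\Upsilon_2^{cp}\cap\mathcal{C}$ is not invariant under the map $(z,\lambda)\mapsto(-z,\lambda)$.
   Context: $\mathcal{C}:=\overline{\mathbb{D}}\times[1,2]\subset\mathbb{C}\times\mathbb{R}$, where $\overline{\mathbb{D}}$ is the closed unit disk. A continuous self-map $f$ of a compact interval is unimodal if it has exactly one interior turning point $c$ (the critical point); it is critically periodic if $f^n(c)=c$ for some $n\geq 1$. Let $\mathcal{F}_2^{cp}$ be the family of continuous, unimodal, critically periodic interval self-maps, and let $h_{top}$ denote topological entropy. The Master Teapot is $\Upsilon_2^{cp}:=\overline{\{(z,\lambda)\in\mathbb{C}\times\mathbb{R}\mid \lambda=e^{h_{top}(f)}\text{ for some }f\in\mathcal{F}_2^{cp},\ z\text{ is a Galois conjugate of }\lambda\}}$. (It is invariant under $(z,\lambda)\mapsto(\bar z,\lambda)$ because Galois conjugates occur in complex conjugate pairs.) *)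

(* Defs.v *)
From mathcomp Require Export all_boot all_order all_algebra.
From mathcomp Require Export all_classical all_reals all_analysis.
From mathcomp Require Export complex.

Set Implicit Arguments.
Unset Strict Implicit.
Unset Printing Implicit Defensive.

Export Order.TTheory GRing.Theory Num.Theory numFieldNormedType.Exports.

Local Open Scope classical_set_scope.
Local Open Scope ring_scope.
Local Open Scope complex_scope.

(* The topology on the complex numbers is the norm topology that every
   numFieldType carries; it is found through the structure, not through the
   bare type R[i]. *)
Notation Cplx R := (R[i] : numFieldType).

(* A self-map of a compact set K of reals is a total function f : R -> R
   mapping K into K; the notions below only use its values on K. *)

(* Topological entropy, after Bowen and Dinaburg.  The points of s are pairwise
   at distance > e for the metric d_n(x, y) = max_(k < n) |f^k x - f^k y|. *)
Definition separated (R : realType) (K : set R) (f : R -> R)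
    (n : nat) (e : R) (s : seq R) : Prop :=
  [/\ uniq s, (forall x, x \in s -> K x) &
      forall x y, x \in s -> y \in s -> x != y ->
        exists2 k, (k < n)%N & e < `|iter k f x - iter k f y|].

Definition max_separated (R : realType) (K : set R) (f : R -> R)
    (n : nat) (e : R) : \bar R :=
  ereal_sup [set ((size s)%:R)%:E | s in separated K f n e].

Definition entropy_at_scale (R : realType) (K : set R) (f : R -> R)
    (e : R) : \bar R :=
  limn_esup (fun n => ((n%:R^-1)%:E * lne (max_separated K f n e))%E).

(* entropy_at_scale is nonincreasing in e, so this limit exists in \bar R. *)
Definition h_top (R : realType) (K : set R) (f : R -> R) : \bar R :=
  lim (entropy_at_scale K f e @[e --> 0^'+]).

(* The turning point may be a maximum or a minimum. *)
Definition unimodal (R : realType) (a b c : R) (f : R -> R) : Prop :=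
  [/\ a < c < b,
      {within `[a, b], continuous f},
      (forall x, a <= x <= b -> a <= f x <= b) &
      ({in `[a, c] &, {homo f : x y / x < y}} /\
       {in `[c, b] &, {homo f : x y / x < y >-> y < x}})
      \/
      ({in `[a, c] &, {homo f : x y / x < y >-> y < x}} /\
       {in `[c, b] &, {homo f : x y / x < y}})].

Definition critically_periodic (R : realType) (c : R) (f : R -> R) : Prop :=
  exists2 n, (0 < n)%N & iter n f c = c.

(* z and l are roots of the same irreducible rational polynomial, which is, up
   to a scalar, the minimal polynomial of l; in particular l is algebraic, and
   is one of its own conjugates. *)
Definition galois_conjugate (R : realType) (z : Cplx R) (l : R) : Prop :=
  exists p : {poly rat},
    [/\ irreducible_poly p,
        root (map_poly ratr p) l%:C &
        root (map_poly ratr p) z].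

Definition teapot_pairs (R : realType) : set (Cplx R * R) :=
  [set w | (exists (a b c : R) (f : R -> R),
              [/\ unimodal a b c f, critically_periodic c f &
                  (w.2)%:E = expeR (h_top `[a, b] f)])
           /\ galois_conjugate w.1 w.2].

Definition master_teapot (R : realType) : set (Cplx R * R) :=
  closure (teapot_pairs (R := R)).

Definition unit_cylinder (R : realType) : set (Cplx R * R) :=
  [set w | `|w.1| <= 1 /\ 1 <= w.2 <= 2].

Definition reflection (R : realType) (w : Cplx R * R) : Cplx R * R :=
  (- w.1, w.2).

(* Main.v *)
Require Import Defs.
From mathcomp Require Import finmap lra ring zify.

(** Let [f] be unimodal with turning point [c] of period [p], and let
    [lam = exp (h_top f) > 1].  Write [x_0 = 0] and
    [x_(k+1) = 1 - e_k * z * x_k], where [e_k] is the side of [c] on which the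
    [k]-th point of the critical orbit lies ([+1] on the right, [-1] on the
    left, for a maximum at [c]).  Milnor and Thurston's theory says that this
    orbit closes up, [x_p = 0], when [z = lam], and that its points then lie on
    the sides prescribed by the [e_k]: it is the critical orbit of the tent map
    of slope [lam] ([kneading_root]).  The equation [x_p = 0] is polynomial
    over the integers, hence holds at every Galois conjugate [z] of [lam] too
    ([kneading_conjugate]).

    Suppose that [lam] is smaller than the golden mean.  The tent map of slope
    [lam] then returns to its turning point from the right, so that
    [e_(p-1) = 1] ([last_symbol_right]) and [x_p = 0] reads
    [1 - z = - e_(p-2) * z ^ 2 * x_(p-2)].  If moreover [|z| < 1], then
    [|x_k| <= 1 / (1 - |z|)], and so [|1 - z| * (1 - |z|) <= |z| ^ 2]
    ([conjugate_region]).  This keeps conjugates away from the negative numbers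
    in the interval from [-1/sqrt 2] to 0 but not from their opposites: the
    itinerary C R L R R L R gives the reciprocal polynomial
    [1 - z - z^2 + z^3 - z^4 - z^5 + z^6], whose root [lam], about 1.556, lies
    below the golden mean and is conjugate to [1 / lam], about 0.643
    ([inverse_conjugate], [witness]).  So [(1 / lam, lam)] is in the teapot,
    while [(- 1 / lam, lam)] has a neighbourhood without any pair.

    The bulk of the work is [kneading_root] for an arbitrary continuous [f].
    Let [q_n] be the number of cut points, the points that meet [c] within the
    first [n] iterates.  Between cut points the iterates are monotone, whence
    both bounds that compare [(n, e)]-separated sets with cut points: there are
    at most about [q_n * n] separated points ([separated_size]), and at least
    [q_(m * n) / 2 ^ n] of them for [m * n] iterates, where [m] is as large as
    one wishes provided that [e] is small ([many_separated]).  So [lam] is the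
    growth rate of [q_n].  Now count, with a sign, the cut points between [c]
    and [x]: since [f] maps this interval onto the one between [f x] and [f c],
    the counts satisfy the kneading recursion up to a bounded error
    ([signed_count_step]).  Summed with the weights [lam ^ - n] and normalised,
    they satisfy it up to an arbitrarily small one
    ([approximate_kneading_orbit]); they vanish at [c], which is both the
    initial and the [p]-th point, and carry the signs [e_k]. *)

Set Implicit Arguments.
Unset Strict Implicit.
Unset Printing Implicit Defensive.

Local Open Scope classical_set_scope.
Local Open Scope ring_scope.

(** * Counting in finite sequences *)

Lemma count_le_inj (T1 T2 : eqType) (s : seq T1) (t : seq T2)
    (P : pred T1) (P' : pred T2) (g : T1 -> T2) :
    uniq s -> (forall x, x \in s -> P x -> (g x \in t) && P' (g x)) ->
    {in [pred x | (x \in s) && P x] &, injective g} ->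
  (count P s <= count P' t)%N.
Proof.
move=> us gt ginj; rewrite -!size_filter -(size_map g).
apply: uniq_leq_size.
  rewrite map_inj_in_uniq ?filter_uniq // => x y.
  rewrite !mem_filter => /andP[Px xs] /andP[Py ys].
  by apply: ginj; rewrite inE ?xs ?ys.
move=> y /mapP[x]; rewrite mem_filter => /andP[Px xs] ->.
by rewrite mem_filter andbC gt.
Qed.

Lemma count_le_sub (T : eqType) (s t : seq T) (P P' : pred T) :
    uniq s -> (forall x, x \in s -> P x -> (x \in t) && P' x) ->
  (count P s <= count P' t)%N.
Proof. by move=> us h; apply: (count_le_inj (g := id)). Qed.

Lemma size_le_fibers (T : eqType) (s : seq T) (g : T -> nat) (N M : nat) :
    (forall x, x \in s -> (g x < N)%N) ->
    (forall i, (count (fun x => g x == i) s <= M)%N) ->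
  (size s <= N * M)%N.
Proof.
elim: N s => [|N IH] s gN gM.
  by case: s gN {gM} => // x s /(_ x); rewrite inE eqxx => /(_ isT).
rewrite -(count_predC (fun x => g x == N)) mulSn leq_add //.
rewrite -size_filter; apply: IH => [x|i].
  by rewrite mem_filter /= => /andP[gxN /gN]; rewrite ltnS leq_eqVlt (negbTE gxN).
by rewrite count_filter (leq_trans _ (gM i)) //; apply: sub_count => x /= /andP[].
Qed.

Lemma seq_min (R : realType) (s : seq R) : s != [::] ->
  exists2 x, x \in s & forall y, y \in s -> x <= y.
Proof.
elim: s => // x s IH _; case: (eqVneq s [::]) => [->|/IH [z zs zmin]].
  by exists x; rewrite ?inE // => y; rewrite inE => /eqP->.
case: (leP x z) => xz.
  exists x; first by rewrite inE eqxx.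
  by move=> y; rewrite inE => /orP[/eqP->//|/zmin]; apply: le_trans.
exists z; first by rewrite inE zs orbT.
by move=> y; rewrite inE => /orP[/eqP->|/zmin //]; apply: ltW.
Qed.

Lemma pos_lower_bound (R : realType) (s : seq R) :
  exists2 e, 0 < e & forall x, x \in s -> 0 < x -> e < x.
Proof.
elim: s => [|x s [e e0 he]]; first by exists 1.
case: (ltP 0 x) => x0; last first.
  by exists e => // y; rewrite inE => /orP[/eqP-> ?|/he //]; lra.
exists (Num.min e (x / 2)); first by rewrite lt_min e0 /=; lra.
move=> y; rewrite inE => /orP[/eqP-> _|/he h y0]; rewrite gt_min.
  by apply/orP; right; lra.
by rewrite h.
Qed.

Lemma min_gap (R : realType) (s : seq R) : exists2 e, 0 < e &
  forall x y, x \in s -> y \in s -> x != y -> 2 * e < `|x - y|.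
Proof.
have [e e0 he] := pos_lower_bound [seq `|x - y| | x <- s, y <- s].
exists (e / 2); first lra.
move=> x y xs ys xy; rewrite mulrC divfK //; apply: he.
  by apply/allpairsP; exists (x, y).
by rewrite normr_gt0 subr_eq0.
Qed.

(** * Cut points of a unimodal map *)

(** Reflecting the interval turns a minimum into a maximum, so it is enough to
    study maps that increase up to [c] and then decrease. *)
Definition peaked (R : realType) (a b c : R) (f : R -> R) : Prop :=
  [/\ a < c < b,
      {within `[a, b], continuous f},
      (forall x, a <= x <= b -> a <= f x <= b),
      {in `[a, c] &, {homo f : x y / x < y}} &
      {in `[c, b] &, {homo f : x y / x < y >-> y < x}}].

Definition cut_set (R : realType) (a b c : R) (f : R -> R) (n : nat) : set R :=
  [set x | a <= x <= b /\ exists2 k, (k < n)%N & iter k f x = c].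

Definition cuts (R : realType) (a b c : R) (f : R -> R) (n : nat) : seq R :=
  fset_set (cut_set a b c f n).

Section Cuts.
Variables (R : realType) (a b c : R) (f : R -> R).
Hypothesis pf : peaked a b c f.

Local Notation Q := (cuts a b c f).
Local Notation I x := (a <= x <= b).

Lemma peaked_itv x : I x -> I (f x).
Proof. by case: pf => _ _ + _ _; apply. Qed.

Lemma peaked_iter n x : I x -> I (iter n f x).
Proof. by move=> Ix; elim: n => //= n IH; apply: peaked_itv. Qed.

Lemma peaked_inc x y : a <= x -> x < y -> y <= c -> f x < f y.
Proof.
move=> ax xy yc; case: pf => _ _ _ inc _; apply: inc => //;
  rewrite in_itv /=; apply/andP; split; lra.
Qed.

Lemma peaked_dec x y : c <= x -> x < y -> y <= b -> f y < f x.
Proof.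
move=> ax xy yc; case: pf => _ _ _ _ dec; apply: dec => //;
  rewrite in_itv /=; apply/andP; split; lra.
Qed.

Lemma peaked_c : I c.
Proof. by case: pf => /andP[? ?] _ _ _ _; apply/andP; split; lra. Qed.

Lemma peaked_le_peak x : I x -> f x <= f c.
Proof.
move=> /andP[ax xb]; case: (ltgtP x c) => [xc|cx|->] //.
  by apply/ltW/peaked_inc.
by apply/ltW/peaked_dec.
Qed.

Lemma peaked_ivt x y v : I x -> I y -> x <= y ->
  Num.min (f x) (f y) <= v <= Num.max (f x) (f y) ->
  exists2 u, x <= u <= y & f u = v.
Proof.
move=> /andP[ax xb] /andP[ay yb] xy h; case: pf => _ fc _ _ _.
have fc' : {within `[x, y], continuous f}.
  apply: continuous_subspaceW fc => z /=; rewrite !in_itv /= => /andP[? ?].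
  by apply/andP; split; lra.
by have [u] := IVT xy fc' h; rewrite in_itv /=; exists u.
Qed.

Lemma cut_setS n :
  cut_set a b c f n.+1 `<=>`
  [set c] `|` [set x | I x /\ cut_set a b c f n (f x)].
Proof.
split=> x /=.
  move=> [Ix [[|k] kn /= kc]]; first by left.
  right; split=> //; split; first exact: peaked_itv.
  by exists k => //; rewrite -iterSr.
move=> [->|[Ix [_ [k kn kc]]]]; first by split; [exact: peaked_c | exists 0%N].
by split=> //; exists k.+1 => //; rewrite iterSr.
Qed.

Lemma cut_set_finite n : finite_set (cut_set a b c f n).
Proof.
elim: n => [|n IH].
  suff -> : cut_set a b c f 0 = set0 by exact: finite_set0.
  by apply/seteqP; split=> x // [_ []].
have [sub _] := cut_setS n.
apply: sub_finite_set sub _; rewrite finite_setU; split; first exact: finite_set1.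
set A := [set _ | _].
have fin (B : set R) : B `<=` A -> {in B &, injective f} -> finite_set B.
  move=> BA injB; rewrite -(eq_finite_set (inj_card_eq injB)).
  by apply: sub_finite_set IH => _ [x xB <-]; have xB' := xB; move: (BA x ltac:(first [exact: xB|exact: set_mem xB])) => -[].
have -> : A = (A `&` [set x | x <= c]) `|` (A `&` [set x | c <= x]).
  apply/seteqP; split=> [x Ax|x [[]|[]]//].
  by case/orP: (le_total x c) => ?; [left|right].
rewrite finite_setU; split; apply: fin => [x []//|x y].
  move=> /set_mem[[/andP[ax _] _] xc] /set_mem[[/andP[ay _] _] yc] fxy.
  by case: (ltgtP x y) => // [/peaked_inc|/peaked_inc];
    move=> /(_ ltac:(done) ltac:(done)); rewrite fxy ltxx.
move=> /set_mem[[/andP[_ xb] _] xc] /set_mem[[/andP[_ yb] _] yc] fxy.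
by case: (ltgtP x y) => // [/peaked_dec|/peaked_dec];
  move=> /(_ ltac:(done) ltac:(done)); rewrite fxy ltxx.
Qed.

Lemma cutsP n x : reflect (cut_set a b c f n x) (x \in Q n).
Proof.
rewrite /cuts (in_fset_set (cut_set_finite n)).
by apply: (iffP idP) => [/set_mem|/mem_set].
Qed.

Lemma cuts_uniq n : uniq (Q n). Proof. exact: fset_uniq. Qed.

Lemma cuts0 : Q 0 = [::].
Proof.
by case E: (Q 0) => [//|x s]; have /cutsP[_ []] : x \in Q 0 by rewrite E inE eqxx.
Qed.

Lemma cuts_itv n x : x \in Q n -> I x. Proof. by move=> /cutsP[]. Qed.

Lemma cutsS n x : (x \in Q n.+1) = (x == c) || (I x && (f x \in Q n)).
Proof.
have [h1 h2] := cut_setS n; apply/idP/idP.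
  move=> /cutsP /h1 [->|[-> /cutsP ->]]; first by rewrite eqxx.
  by rewrite orbT.
move=> h; apply/cutsP/h2; case/orP: h => [/eqP|/andP[Ix /cutsP]]; first by left.
by right.
Qed.

Lemma cuts_sub n m x : (n <= m)%N -> x \in Q n -> x \in Q m.
Proof.
move=> nm /cutsP[Ix [k kn kc]]; apply/cutsP; split=> //.
by exists k => //; apply: leq_trans nm.
Qed.

Lemma cutsD n m x : x \in Q (n + m) -> x \notin Q n -> iter n f x \in Q m.
Proof.
move=> /cutsP[Ix [k kn kc]] /cutsP h; apply/cutsP; split; first exact: peaked_iter.
have nk : (n <= k)%N by rewrite leqNgt; apply/negP => ?; apply: h; split=> //; exists k.
by exists (k - n)%N; [lia | rewrite -iterD subnK].
Qed.

Definition no_cut n (x y : R) := forall q, q \in Q n -> x <= q <= y -> False.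

Lemma no_cutS n x y : I x -> I y -> x <= y -> no_cut n.+1 x y ->
  y < c /\ no_cut n (f x) (f y) \/ c < x /\ no_cut n (f y) (f x).
Proof.
move=> Ix Iy xy h.
have nc : (y < c) \/ (c < x).
  case: (ltP y c) => [|cy]; first by left.
  case: (ltP c x) => [|xc]; first by right.
  by case: (h c); rewrite ?cutsS ?eqxx // xc cy.
case: nc => hc; [left|right]; split=> // q qQ hq.
  have [|u xuy fu] := @peaked_ivt x y q Ix Iy xy.
    by case/andP: hq => ? ?; rewrite ge_min le_max; apply/andP; split; apply/orP; [left|right].
  apply: (h u) => //; rewrite cutsS; apply/orP; right; rewrite fu qQ andbT.
  by move: Ix Iy xuy => /andP[? ?] /andP[? ?] /andP[? ?]; apply/andP; split; lra.
have [|u xuy fu] := @peaked_ivt x y q Ix Iy xy.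
  by case/andP: hq => ? ?; rewrite ge_min le_max; apply/andP; split; apply/orP; [right|left].
apply: (h u) => //; rewrite cutsS; apply/orP; right; rewrite fu qQ andbT.
by move: Ix Iy xuy => /andP[? ?] /andP[? ?] /andP[? ?]; apply/andP; split; lra.
Qed.

(** Only the passages through [c] can break monotonicity, and between two
    neighbouring cut points there are none. *)
Lemma no_cut_mono n k x y : I x -> I y -> x <= y -> no_cut n x y -> (k <= n)%N ->
  (forall u v, x <= u -> u < v -> v <= y -> iter k f u < iter k f v) \/
  (forall u v, x <= u -> u < v -> v <= y -> iter k f v < iter k f u).
Proof.
elim: k n x y => [|k IH] n x y Ix Iy xy h kn; first by left.
case: n h kn => // n h kn.
move: (Ix) (Iy) => /andP[ax xb] /andP[ay yb].
have fI := peaked_itv.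
have [[yc h']|[cx h']] := no_cutS Ix Iy xy h.
  have inc u v : x <= u -> u < v -> v <= y -> f u < f v.
    by move=> ? ? ?; apply: peaked_inc; lra.
  have inc' u v : x <= u -> u <= v -> v <= y -> f u <= f v.
    by move=> xu; rewrite le_eqVlt => /orP[/eqP-> //|uv vy]; apply/ltW/inc.
  have := IH n (f x) (f y) (fI _ Ix) (fI _ Iy) (inc' _ _ (lexx _) xy (lexx _)) h' kn.
  by case=> mono; [left|right] => u v xu uv vy; rewrite !iterSr;
    (apply: mono; [apply: inc' => //; lra|exact: inc|apply: inc' => //; lra]).
have dec u v : x <= u -> u < v -> v <= y -> f v < f u.
  by move=> ? ? ?; apply: peaked_dec; lra.
have dec' u v : x <= u -> u <= v -> v <= y -> f v <= f u.
  by move=> xu; rewrite le_eqVlt => /orP[/eqP-> //|uv vy]; apply/ltW/dec.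
have := IH n (f y) (f x) (fI _ Iy) (fI _ Ix) (dec' _ _ (lexx _) xy (lexx _)) h' kn.
by case=> mono; [right|left] => u v xu uv vy; rewrite !iterSr;
  (apply: mono; [apply: dec' => //; lra|exact: dec|apply: dec' => //; lra]).
Qed.

Lemma no_cut_inj n x y : I x -> I y -> no_cut n x y -> x < y ->
  iter n f x != iter n f y.
Proof.
move=> Ix Iy h xy.
have [] := no_cut_mono Ix Iy (ltW xy) h (leqnn n) => /(_ x y (lexx _) xy (lexx _)).
  by move=> /lt_eqF ->.
by move=> /gt_eqF ->.
Qed.

(** Cut points get the odd values and the gaps between them the even ones. *)
Definition gap n (x : R) : nat :=
  (count (fun q => (q < x)%R) (Q n) + count (fun q => (q <= x)%R) (Q n))%N.

Lemma gap_bound n x : (gap n x < (size (Q n)).*2.+1)%N.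
Proof. by rewrite ltnS -addnn leq_add // count_size. Qed.

Lemma gap_eq n x y : gap n x = gap n y -> x < y -> no_cut n x y.
Proof.
move=> e xy q qQ /andP[xq qy].
have h1 : (count (fun q => (q < x)%R) (Q n) <= count (fun q => (q < y)%R) (Q n))%N.
  by apply: sub_count => z /= zx; apply: lt_trans xy.
have h2 : (count (fun q => (q <= x)%R) (Q n) <= count (fun q => (q <= y)%R) (Q n))%N.
  by apply: sub_count => z /= zx; apply: le_trans (ltW xy).
have pos : (0 < count (pred1 q) (Q n))%N by rewrite -has_count has_pred1.
move: e; rewrite /gap => e; move: xq; rewrite le_eqVlt => /orP[/eqP exq|xq].
  (* [q = x] is a cut point: it is counted strictly below [y] only *)
  have : (count (fun q => (q < x)%R) (Q n) + count (pred1 q) (Q n)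
          <= count (fun q => (q < y)%R) (Q n))%N.
    rewrite -count_predUI [X in (_ + X)%N](_ : _ = 0%N) ?addn0.
      by apply: sub_count => z /= /orP[zx|/eqP->]; [exact: lt_trans xy | rewrite -exq].
    by apply/eqP; rewrite -leqn0 leqNgt -has_count; apply/hasPn => z _ /=;
       apply/negP => /andP[zx /eqP zq]; move: zx; rewrite zq exq ltxx.
  lia.
(* [q] lies strictly between [x] and [y]: it raises the second count *)
have : (count (fun q => (q <= x)%R) (Q n) + count (pred1 q) (Q n)
        <= count (fun q => (q <= y)%R) (Q n))%N.
  rewrite -count_predUI [X in (_ + X)%N](_ : _ = 0%N) ?addn0.
    by apply: sub_count => z /= /orP[zx|/eqP-> //]; exact: le_trans (ltW xy).
  by apply/eqP; rewrite -leqn0 leqNgt -has_count; apply/hasPn => z _ /=;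
     apply/negP => /andP[zx /eqP zq]; move: zx; rewrite zq leNgt xq.
lia.
Qed.

(** Between cut points of [f^n] the iterate [f^n] is injective, so it
    transports at most all the cut points of [f^m] into each gap. *)
Lemma cuts_submult n m :
  ((size (Q (n + m))).+1 <= (size (Q n)).+1 * (size (Q m)).+1)%N.
Proof.
suff h : (count (fun x => x \notin Q n) (Q (n + m)) <= (size (Q n)).+1 * size (Q m))%N.
  rewrite -(count_predC (fun x => x \in Q n)) mulnS addSn ltnS leq_add //.
  by rewrite -count_predT; apply: count_le_sub; rewrite ?cuts_uniq // => x _ ->.
rewrite -size_filter.
apply: (size_le_fibers (g := fun x => count (fun q => (q < x)%R) (Q n))) => [x _|i].
  by rewrite ltnS count_size.
rewrite count_filter -(count_predT (Q m)).
apply: (count_le_inj (g := iter n f)); first exact: cuts_uniq.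
  by move=> x xQ /andP[_ xn]; rewrite andbT; apply: cutsD.
have wl x y : x \in Q (n + m) -> x \notin Q n -> y \in Q (n + m) -> y \notin Q n ->
    count (fun q => (q < x)%R) (Q n) = count (fun q => (q < y)%R) (Q n) ->
    x < y -> iter n f x != iter n f y.
  move=> xQ xn yQ yn e xy.
  apply: no_cut_inj; rewrite ?(cuts_itv xQ) ?(cuts_itv yQ) // => q qQ /andP[xq qy].
  apply: (@gap_eq n x y _ xy q); rewrite ?xq //.
  rewrite /gap; have ee z : z \notin Q n ->
     count (fun q => (q <= z)%R) (Q n) = count (fun q => (q < z)%R) (Q n).
    move=> zn; apply: eq_in_count => u uQ; rewrite le_eqVlt.
    by case: eqP => // uz; rewrite -uz uQ in zn.
  by rewrite !ee // e.
move=> x y; rewrite !inE => /and3P[xQ /eqP xi xn] /and3P[yQ /eqP yi yn] e.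
case: (ltgtP x y) => // h.
  by have := wl _ _ xQ xn yQ yn (etrans xi (esym yi)) h; rewrite e eqxx.
by have := wl _ _ yQ yn xQ xn (etrans yi (esym xi)) h; rewrite e eqxx.
Qed.

Lemma cuts_submultX n k : ((size (Q (n * k))).+1 <= (size (Q n)).+1 ^ k)%N.
Proof.
elim: k => [|k IH]; first by rewrite muln0 cuts0.
by rewrite mulnS expnS (leq_trans (cuts_submult _ _)) // leq_mul.
Qed.

Lemma size_cuts_le n m : (n <= m)%N -> (size (Q n) <= size (Q m))%N.
Proof. by move=> nm; apply: uniq_leq_size (cuts_uniq _) _ => x; apply: cuts_sub. Qed.

End Cuts.

(** * Cut points and separated sets *)

Section Separated.
Variables (R : realType) (a b c : R) (f : R -> R).
Hypothesis pf : peaked a b c f.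

Local Notation Q := (cuts a b c f).
Local Notation I x := (a <= x <= b).

(** On a gap all iterates are monotone, so the total distance travelled by the
    iterates is additive along the gap; it stays below [n * (b - a)] and grows
    by more than [e] from one separated point to the next. *)
Lemma separated_in_gap n e i s : 0 < e -> uniq s -> (forall x, x \in s -> I x) ->
    (forall x y, x \in s -> y \in s -> x != y ->
        exists2 k, (k < n)%N & e < `|iter k f x - iter k f y|) ->
    (forall x, x \in s -> gap a b c f n x = i) ->
  (size s <= (Num.truncn (n%:R * (b - a) / e)).+1)%N.
Proof.
move=> e0 us Is sep si.
case: (eqVneq s [::]) => [->//|/seq_min [x0 x0s x0min]].
pose Phi x := \sum_(k < n) `|iter k f x - iter k f x0|.
have step x y : x \in s -> y \in s -> x < y -> Phi x + e < Phi y.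
  move=> xs ys xy.
  have [k kn ke] := sep x y xs ys (negbT (lt_eqF xy)).
  have x0y : x0 < y by apply: le_lt_trans xy; apply: x0min.
  have nc := gap_eq (etrans (si _ x0s) (esym (si _ ys))) x0y.
  have add j : (j <= n)%N ->
    `|iter j f y - iter j f x0| = `|iter j f x - iter j f x0| + `|iter j f x - iter j f y|.
    move=> jn; have x0x := x0min x xs.
    have := no_cut_mono pf (Is _ x0s) (Is _ ys) (ltW x0y) nc jn.
    case=> mono.
      have h1 := mono x y x0x xy (lexx _).
      have h2 : iter j f x0 <= iter j f x.
        by move: x0x; rewrite le_eqVlt => /orP[/eqP->//|h]; apply/ltW/mono => //; exact: ltW.
      by rewrite (@ger0_norm _ (_ - iter j f x0)) ?(@ger0_norm _ (_ - iter j f x0)) 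
        ?(@ler0_norm _ (_ - iter j f y)); lra.
    have h1 := mono x y x0x xy (lexx _).
    have h2 : iter j f x <= iter j f x0.
      by move: x0x; rewrite le_eqVlt => /orP[/eqP->//|h]; apply/ltW/mono => //; exact: ltW.
    by rewrite (@ler0_norm _ (_ - iter j f x0)) ?(@ler0_norm _ (_ - iter j f x0)) 
      ?(@ger0_norm _ (_ - iter j f y)); lra.
  have -> : Phi y = Phi x + \sum_(k < n) `|iter k f x - iter k f y|.
    by rewrite -big_split; apply: eq_bigr => j _; apply: add; exact: ltnW.
  rewrite ltrD2l (lt_le_trans ke) // (bigD1 (Ordinal kn)) //= lerDl.
  by apply: sumr_ge0 => j _; exact: normr_ge0.
have Phi0 x : 0 <= Phi x by apply: sumr_ge0 => j _; exact: normr_ge0.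
have PhiM x : x \in s -> Phi x <= n%:R * (b - a).
  move=> xs; rewrite -[X in X%:R * _](card_ord n) mulr_natl -sumr_const.
  apply: ler_sum => j _.
  move: (peaked_iter pf j (Is _ xs)) (peaked_iter pf j (Is _ x0s)).
  by move=> /andP[? ?] /andP[? ?]; rewrite ler_norml; apply/andP; split; lra.
rewrite -(size_map (fun x => Num.truncn (Phi x / e))) -(size_iota 0 (Num.truncn _).+1).
apply: uniq_leq_size.
  rewrite map_inj_in_uniq //.
  have lt x y : x \in s -> y \in s -> x < y ->
      Num.truncn (Phi x / e) <> Num.truncn (Phi y / e).
    move=> xs ys xy tr; have h := step x y xs ys xy.
    have /truncn_itv/andP[x1 x2] : 0 <= Phi x / e by rewrite divr_ge0 // ltW.
    have /truncn_itv/andP[y1 y2] : 0 <= Phi y / e by rewrite divr_ge0 // ltW.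
    have : Phi x / e + 1 < Phi y / e.
      by rewrite -[X in _ + X < _](divff (lt0r_neq0 e0)) -mulrDl ltr_pM2r // invr_gt0.
    by rewrite tr in x1; rewrite -natr1 in y2; lra.
  move=> x y xs ys e'; case: (ltgtP x y) => // h; first by case: (lt x y xs ys h).
  by case: (lt y x ys xs h).
move=> _ /mapP[x xs ->]; rewrite mem_iota add0n leq0n /= ltnS.
apply: le_truncn; rewrite ler_pM2r ?invr_gt0 //; exact: PhiM.
Qed.

(** There are [2 * size (Q n) + 1] classes: the cut points and the gaps. *)
Lemma separated_size n e s : 0 < e -> separated `[a, b] f n e s ->
  (size s <= (size (Q n)).*2.+1 * (Num.truncn (n%:R * (b - a) / e)).+1)%N.
Proof.
move=> e0 [us sI sep]; apply: (size_le_fibers (g := gap a b c f n)).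
  by move=> x _; exact: gap_bound.
move=> i; rewrite -size_filter; apply: (@separated_in_gap n e i) => //.
- exact: filter_uniq.
- by move=> x; rewrite mem_filter => /andP[_ /sI]; rewrite /= in_itv.
- move=> x y; rewrite !mem_filter => /andP[_ xs] /andP[_ ys]; exact: sep.
- by move=> x; rewrite mem_filter => /andP[/eqP].
Qed.

Definition shadow N e (x z : R) :=
  all (fun k => `|iter k f x - iter k f z| <= e) (iota 0 N).

Lemma shadowP N e x z :
  reflect (forall k, (k < N)%N -> `|iter k f x - iter k f z| <= e) (shadow N e x z).
Proof.
by apply: (iffP allP) => h k kN; apply: h; move: kN; rewrite mem_iota add0n leq0n.
Qed.

(** An interval shorter than the gaps of [cuts m] contains at most one cut point,
    which leaves two monotone branches of [f^m]; each step of length [m] thus at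
    most doubles the number of cut points shadowed by the orbit of [z]. *)
Lemma shadowed_cuts m n e z B :
    (forall x y, x \in Q m -> y \in Q m -> x != y -> 2 * e < `|x - y|) ->
    uniq B -> {subset B <= Q (m * n)} ->
    (forall x i, x \in B -> (i < n)%N ->
       `|iter (i * m) f x - iter (i * m) f z| <= e) ->
  (size B < 2 ^ n)%N.
Proof.
move=> gapm; elim: n z B => [|n IH] z B uB BQ close.
  by case: B uB BQ {close} => // x B _ /(_ x); rewrite muln0 cuts0 // inE eqxx => /(_ isT).
have near0 x : x \in B -> `|x - z| <= e by move=> xB; exact: (close x 0%N xB).
have B1 : (count (fun x => x \in Q m) B <= 1)%N.
  rewrite -size_filter; case E: [seq _ <- _ | _] => [//|x [//|y t]].
  have : uniq [:: x, y & t] by rewrite -E filter_uniq.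
  have: x \in [:: x, y & t] by rewrite inE eqxx.
  have: y \in [:: x, y & t] by rewrite !inE eqxx orbT.
  rewrite -E !mem_filter => /andP[yQ yB] /andP[xQ xB]; rewrite E cons_uniq inE negb_or.
  move=> /andP[/andP[xy _] _].
  move: (gapm x y xQ yQ xy) (near0 _ xB) (near0 _ yB).
  rewrite (_ : x - y = (x - z) - (y - z)); last lra.
  by move: (ler_normB (x - z) (y - z)); lra.
have B2 : (count (fun x => x \notin Q m) B <= 2 * (2 ^ n).-1)%N.
  rewrite -size_filter.
  (* The side of the only nearby cut point on which [x] lies. *)
  pose g x := nat_of_bool (has (fun q => (`|q - z| <= e) && (q < x)) (Q m)).
  apply: (size_le_fibers (g := g)) => [x _|i]; first by rewrite /g; case: has.
  rewrite -size_filter -filter_predI; set F := [seq _ <- B | _].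
  have inj : {in F &, injective (iter m f)}.
    have lt x y : x \in F -> y \in F -> x < y -> iter m f x != iter m f y.
      rewrite !mem_filter /= => /andP[/andP[/eqP gx xQ] xB] /andP[/andP[/eqP gy yQ] yB] xy.
      apply: (no_cut_inj pf) => //; rewrite ?(cuts_itv pf (BQ _ xB)) ?(cuts_itv pf (BQ _ yB)) //.
      move=> q qQ /andP[xq qy].
      have qy' : q < y by rewrite lt_neqAle qy andbT; apply: contraNneq yQ => <-.
      have xq' : x < q by rewrite lt_neqAle xq andbT; apply: contraNneq xQ => ->.
      have qz : `|q - z| <= e.
        move: (near0 _ xB) (near0 _ yB); rewrite !ler_norml => /andP[? ?] /andP[? ?].
        by apply/andP; split; lra.
      have : has (fun q => (`|q - z| <= e) && (q < x)) (Q m).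
        suff : has (fun q => (`|q - z| <= e) && (q < y)) (Q m).
          by move: gx; rewrite -gy /g; do 2 case: has.
        by apply/hasP; exists q => //; rewrite qz.
      move=> /hasP[q' q'Q /andP[q'z q'x]].
      have qq' : q != q' by apply: contraTneq q'x => <-; rewrite -leNgt ltW.
      clear gx gy.
      move: (gapm _ _ qQ q'Q qq').
      rewrite (_ : q - q' = (q - z) - (q' - z)); last by rewrite opprB addrA subrK.
      by move: (ler_normB (q - z) (q' - z)); lra.
    move=> x y xF yF e'; case: (ltgtP x y) => // h.
      by have := lt _ _ xF yF h; rewrite e' eqxx.
    by have := lt _ _ yF xF h; rewrite e' eqxx.
  rewrite -(size_map (iter m f)) -ltnS prednK ?expn_gt0 //.
  apply: (IH (iter m f z)).
  - by rewrite map_inj_in_uniq // filter_uniq.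
  - move=> _ /mapP[x + ->]; rewrite mem_filter /= => /andP[/andP[_ xQ] xB].
    by apply: (cutsD pf) => //; rewrite -mulnS; exact: BQ.
  - move=> _ i' /mapP[x + ->] i'n; rewrite mem_filter => /andP[_ xB].
    by rewrite -!iterD addnC -mulSn; exact: close.
rewrite -(count_predC (fun x => x \in Q m)) expnS.
apply: (leq_ltn_trans (leq_add B1 B2)).
by move: (expn_gt0 2 n) => /=; move: (2 ^ n)%N => u; lia.
Qed.

(** A maximal separated subset of [t] shadows all of [t]. *)
Lemma maximal_separated N e t : 0 < e -> uniq t -> (forall x, x \in t -> I x) ->
  exists2 s, separated `[a, b] f N e s &
    forall x, x \in t -> has (shadow N e x) s.
Proof.
move=> e0; elim: t => [|x t IH] /=; first by exists [::].
move=> /andP[xt ut] tI; have [|s [us sI sep] cov] := IH ut.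
  by move=> y yt; apply: tI; rewrite inE yt orbT.
case hx: (has (shadow N e x) s).
  by exists s => // y; rewrite inE => /orP[/eqP->|/cov].
have far y : y \in s -> exists2 k, (k < N)%N & e < `|iter k f x - iter k f y|.
  move=> ys; move: hx => /negbT/hasPn/(_ y ys)/allPn[k].
  by rewrite mem_iota add0n leq0n /= -ltNge => ? ?; exists k.
have refl y : shadow N e y y by apply/shadowP => k _; rewrite subrr normr0 ltW.
exists (x :: s).
  split.
  - by rewrite /= us andbT; apply/negP => xs; move: hx => /negbT/hasPn/(_ x xs); rewrite refl.
  - move=> y; rewrite inE => /orP[/eqP->|/sI //].
    by rewrite /= in_itv /=; apply: tI; rewrite inE eqxx.
  - move=> y z; rewrite !inE => /orP[/eqP->|ys] /orP[/eqP->|zs]; rewrite ?eqxx //.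
    + by move=> _; exact: far.
    + by move=> _; have [k ? ?] := far _ ys; exists k => //; rewrite distrC.
    + exact: sep.
move=> y; rewrite inE => /orP[/eqP->|/cov /= ->]; rewrite ?orbT //.
by rewrite /= refl.
Qed.

(** Every cut point is shadowed by a point of a maximal separated set, and no
    point shadows more than [2 ^ n] of them.  The loss [2 ^ n] is small against
    the growth over [m * n] steps once [m] is large. *)
Lemma many_separated m : (0 < m)%N -> exists2 e, 0 < e & forall n,
  exists2 s, separated `[a, b] f (m * n) e s &
    (size (Q (m * n)) <= size s * 2 ^ n)%N.
Proof.
move=> m0; have [e e0 he] := min_gap (Q m); exists e => // n.
have [|s sep cov] := maximal_separated (m * n) e0 (cuts_uniq a b c f (m * n)).
  by move=> x /(cuts_itv pf).
exists s => //.
apply: (size_le_fibers (g := fun x => find (shadow (m * n) e x) s)) => [x /cov|i].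
  by rewrite has_find.
rewrite -size_filter; apply: ltnW.
apply: (@shadowed_cuts m n e (nth c s i)) => //.
- by rewrite filter_uniq // cuts_uniq.
- by move=> x; rewrite mem_filter => /andP[].
- move=> x j; rewrite mem_filter => /andP[/eqP <- xQ] jn.
  apply/(shadowP (m * n)); first exact: nth_find (cov _ xQ).
  by rewrite mulnC ltn_pmul2l.
Qed.

End Separated.

(** * Topological entropy is the growth rate of the cut points *)

Section Limsup.
Variable R : realType.
Local Open Scope ereal_scope.

Lemma limn_esup_le (u : (\bar R)^nat) (x : \bar R) N :
  (forall n, (N <= n)%N -> u n <= x) -> limn_esup u <= x.
Proof.
move=> h; apply: (@le_trans _ _ (ereal_sup (u @` [set n | (N <= n)%N]))).
  apply: ereal_inf_lbound => /=; exists [set n | (N <= n)%N] => //; by exists N.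
by apply: ge_ereal_sup => _ [n /= Nn <-]; exact: h.
Qed.

Lemma limn_esup_lt (u : (\bar R)^nat) (x : \bar R) :
  limn_esup u < x -> exists N, forall n, (N <= n)%N -> u n < x.
Proof.
move=> /ereal_inf_lt[_ [V [N _ NV] <-] h]; exists N => n Nn.
by apply: le_lt_trans h; apply: ereal_sup_ubound; exists n => //; exact: NV.
Qed.

End Limsup.

Section Entropy.
Variables (R : realType) (K : set R) (f : R -> R).
Local Open Scope ereal_scope.

Lemma max_separated_ge n e s : separated K f n e s ->
  ((size s)%:R)%:E <= max_separated K f n e.
Proof. by move=> h; apply: ereal_sup_ubound; exists s. Qed.

Lemma max_separated_ge0 n e : 0 <= max_separated K f n e.
Proof. by apply: (@max_separated_ge n e [::]); split. Qed.

Lemma max_separated_le n e x :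
  (forall s, separated K f n e s -> ((size s)%:R <= x)%R) ->
  max_separated K f n e <= x%:E.
Proof. by move=> h; apply: ge_ereal_sup => _ [s /h ? <-]; rewrite lee_fin. Qed.

Lemma entropy_at_scale_noninc e1 e2 : (e1 <= e2)%R ->
  entropy_at_scale K f e2 <= entropy_at_scale K f e1.
Proof.
move=> e12; apply: le_ereal_inf_tmp => _ [V FV <-].
apply: (@le_trans _ _ (ereal_sup ((fun n => (n%:R^-1)%:E * lne (max_separated K f n e2)) @` V))).
  by apply: ereal_inf_lbound; exists V.
apply: ge_ereal_sup => _ [n Vn <-].
apply: (@le_trans _ _ ((n%:R^-1)%:E * lne (max_separated K f n e1))); last first.
  by apply: ereal_sup_ubound; exists n.
apply: lee_wpmul2l; first by rewrite lee_fin invr_ge0.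
rewrite lee_lne ?in_itv /= ?max_separated_ge0 ?leey //.
apply: ereal_sup_le => _ [s [us sK sep] <-]; exists s => //; split=> // x y xs ys xy.
by have [k kn ke] := sep x y xs ys xy; exists k => //; apply: le_lt_trans ke.
Qed.

(** The limit in the definition of the entropy is a supremum, because finer
    scales separate more points. *)
Lemma h_topE :
  h_top K f = ereal_sup [set entropy_at_scale K f e | e in [set e | (0 < e)%R]].
Proof.
apply/cvg_lim => //.
have := @nonincreasing_at_right_cvge R (entropy_at_scale K f) 0%R +oo%O isT.
rewrite (_ : [set` _] = [set e | (0 < e)%R]); last first.
  by apply/seteqP; split=> e /=; rewrite in_itv /= andbT.
by apply=> x y _ _; exact: entropy_at_scale_noninc.
Qed.

Lemma entropy_at_scale_le_h_top e : (0 < e)%R -> entropy_at_scale K f e <= h_top K f.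
Proof. by move=> e0; rewrite h_topE; apply: ereal_sup_ubound; exists e. Qed.

Lemma h_top_le x : (forall e, (0 < e)%R -> entropy_at_scale K f e <= x) ->
  h_top K f <= x.
Proof. by move=> h; rewrite h_topE; apply: ge_ereal_sup => _ [e /= /h ? <-]. Qed.

Lemma entropy_rate_le n e x :
  (0 < n)%N -> (forall s, separated K f n e s -> ((size s)%:R <= expR (n%:R * x))%R) ->
  (n%:R^-1)%:E * lne (max_separated K f n e) <= x%:E.
Proof.
move=> n0 h; have n0' : (0 < n%:R :> R)%R by rewrite ltr0n.
have -> : x%:E = (n%:R^-1)%:E * (n%:R * x)%:E.
  by rewrite -EFinM mulrA mulVf ?mul1r // gt_eqF.
apply: lee_wpmul2l; first by rewrite lee_fin invr_ge0 ltW.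
have -> : (n%:R * x)%:E = lne (expR (n%:R * x))%:E.
  by rewrite lne_EFin ?expR_gt0 // expRK.
rewrite lee_lne ?in_itv /= ?max_separated_ge0 ?leey ?lee_fin ?expR_ge0 //.
exact: max_separated_le.
Qed.

Lemma entropy_rate_lt n e x s :
  (0 < n)%N -> (n%:R^-1)%:E * lne (max_separated K f n e) < x%:E ->
  separated K f n e s -> ((size s)%:R <= expR (n%:R * x))%R.
Proof.
move=> n0 h sep; have n0' : (0 < n%:R :> R)%R by rewrite ltr0n.
case: (posnP (size s)) => [->|s0]; first exact: expR_ge0.
have s0' : (0 < (size s)%:R :> R)%R by rewrite ltr0n.
rewrite -ler_ln ?posrE ?expR_gt0 // expRK -lee_fin -(lne_EFin s0').
apply: (@le_trans _ _ (lne (max_separated K f n e))).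
  rewrite lee_lne ?in_itv /= ?max_separated_ge0 ?leey ?lee_fin ?(ltW s0') //.
  exact: max_separated_ge.
rewrite ltW // EFinM -lte_pdivrMl //.
Qed.

End Entropy.

Lemma expR_beats_linear (R : realType) (d C D : R) : 0 < d -> 0 <= C -> 0 <= D ->
  exists N, forall n, (N <= n)%N -> C * (n%:R * D + 1) <= expR (n%:R * d).
Proof.
move=> d0 C0 D0; pose k := C + 2 * C * D / d.
have k0 : 0 <= k by rewrite addr_ge0 // divr_ge0 ?mulr_ge0 // ltW.
exists (Num.truncn (2 * k / d)).+1 => n Nn.
have nk : k <= n%:R * (d / 2).
  have /truncn_itv/andP[_ h] : 0 <= 2 * k / d by rewrite divr_ge0 ?mulr_ge0 // ltW.
  have : 2 * k / d <= n%:R by apply: (le_trans (ltW h)); rewrite ler_nat.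
  by rewrite ler_pdivrMr //; lra.
have -> : n%:R * d = n%:R * (d / 2) + n%:R * (d / 2) by lra.
rewrite expRD; have e1 : 1 + n%:R * (d / 2) <= expR (n%:R * (d / 2)) by exact: expR_ge1Dx.
have n0 : 0 <= n%:R :> R by [].
apply: (@le_trans _ _ (k * (1 + n%:R * (d / 2)))); last first.
  apply: ler_pM => //; first by nra.
  by apply: le_trans e1; lra.
have e2 : k * (1 + n%:R * (d / 2)) = k + n%:R * (k * d / 2) by lra.
have e3 : k * d / 2 = C * d / 2 + C * D.
  by rewrite /k mulrDl divfK ?gt_eqF //; lra.
rewrite e2 e3 mulrDr mulr1 [C * (_ * D)](_ : _ = n%:R * (C * D)); last by lra.
have h1 : 0 <= n%:R * (C * d / 2) by rewrite !mulr_ge0 ?invr_ge0 // ltW.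
have h2 : C <= k by rewrite lerDl divr_ge0 ?mulr_ge0 // ltW.
by lra.
Qed.

Section EntropyCuts.
Variables (R : realType) (a b c : R) (f : R -> R).
Hypothesis pf : peaked a b c f.
Local Notation Q := (cuts a b c f).

(** By [cuts_submultX] the cut points grow at most like the powers of
    [(size (Q m)).+1] over multiples of [m]; the factor [n * (b - a) / e] lost in
    [separated_size] is subexponential. *)
Lemma h_top_le_cuts m : (0 < m)%N ->
  (h_top `[a, b] f <= (ln ((size (Q m)).+1)%:R / m%:R)%:E)%E.
Proof.
move=> m0; apply: h_top_le => e e0; apply/lee_addgt0Pr => d d0.
rewrite -EFinD; set A := ln _ / _; set L := ((size (Q m)).+1)%:R in A *.
have m0' : 0 < m%:R :> R by rewrite ltr0n.
have L1 : 1 <= L by rewrite ler1n.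
have ab : 0 <= b - a by case: pf => /andP[? ?] *; lra.
have D0 : 0 <= (b - a) / e by rewrite divr_ge0 // ltW.
have C0 : 0 <= 2 * L by lra.
have [N hN] := expR_beats_linear d0 C0 D0.
apply: (@limn_esup_le _ _ _ N.+1) => n Nn.
apply: entropy_rate_le; first exact: leq_trans Nn.
move=> s /(separated_size pf e0); rewrite -(ler_nat R) natrM => h.
apply: (le_trans h) => {h}.
have q1 : ((size (Q n)).*2.+1)%:R <= 2 * L * expR (n%:R * A).
  apply: (@le_trans _ _ (2 * L ^+ (n %/ m).+1)).
    rewrite -natrX -natrM ler_nat.
    apply: (@leq_trans (2 * (size (Q n)).+1)); first by lia.
    rewrite leq_mul2l /=; apply: leq_trans (cuts_submultX pf m (n %/ m).+1).
    rewrite ltnS; apply: (size_cuts_le pf).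
    by rewrite mulnS mulnC {1}(divn_eq n m) addnC leq_add2r ltnW // ltn_mod.
  rewrite exprS mulrA ler_pM2l; last lra.
  rewrite -[X in X ^+ _](@lnK _ L) ?posrE; last lra.
  rewrite -expRM_natl ler_expR /A mulrCA [X in X <= _]mulrC.
  apply: ler_wpM2l; first exact: ln_ge0.
  by rewrite ler_pdivlMr // -natrM ler_nat leq_divM.
have q2 : ((Num.truncn (n%:R * (b - a) / e)).+1)%:R <= n%:R * ((b - a) / e) + 1.
  rewrite -natr1 lerD2r mulrA.
  have /truncn_itv/andP[] // : 0 <= n%:R * (b - a) / e by rewrite -mulrA mulr_ge0.
apply: (le_trans (ler_pM _ _ q1 q2)) => //.
rewrite [n%:R * (A + d)]mulrDr expRD [2 * L * expR _]mulrC -mulrA ler_pM2l ?expR_gt0 //.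
by apply: hN; apply: ltnW.
Qed.

(** The exponents [y < ln mu] leave room for the factor [2 ^ n] of
    [many_separated]: [m] is chosen such that [2 <= (mu / expR y) ^ m]. *)
Lemma cuts_growth_le mu : 1 < mu -> (h_top `[a, b] f < (ln mu)%:E)%E ->
  exists C N, forall n, (N <= n)%N -> (size (Q n))%:R <= C * mu ^+ n.
Proof.
move=> mu1 hmu.
have [y yh ymu] : exists2 y, (h_top `[a, b] f < y%:E)%E & y < ln mu.
  case: (h_top _ f) hmu => [r|//|].
    by rewrite lte_fin => h; exists ((r + ln mu) / 2); rewrite ?lte_fin; lra.
  by move=> _; exists (ln mu - 1); [exact: ltNyr|lra].
have [m m0 hm] : exists2 m, (0 < m)%N & 2 <= expR (m%:R * (ln mu - y)).
  exists (Num.truncn (ln mu - y)^-1).+1 => //.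
  have d0 : 0 < ln mu - y by lra.
  have /truncn_itv/andP[_ h] : 0 <= (ln mu - y)^-1 by rewrite invr_ge0 ltW.
  apply: le_trans (expR_ge1Dx _).
  move: h; set u := (_.+1)%:R => h.
  have : 1 < u * (ln mu - y) by rewrite -ltr_pdivrMr // div1r.
  by move: (u * _) => v; lra.
have [e e0 many] := many_separated pf m0.
have [N hN] := limn_esup_lt (le_lt_trans (entropy_at_scale_le_h_top `[a, b] f e0) yh).
have mu0 : 0 < mu by lra.
exists (mu ^+ m), (m * N.+1)%N => k kN.
have kN' : (N < k %/ m)%N by rewrite leq_divRL // mulnC.
have [s sep hs] := many (k %/ m).+1.
have mk : (k < m * (k %/ m).+1)%N by rewrite mulnC; exact: ltn_ceil.
apply: (@le_trans _ _ (size (Q (m * (k %/ m).+1)))%:R).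
  by rewrite ler_nat; apply: (size_cuts_le pf); exact: ltnW.
apply: (@le_trans _ _ (mu ^+ (m * (k %/ m).+1))); last first.
  rewrite mulnS exprD ler_pM2l ?exprn_gt0 //.
  by apply: ler_weXn2l; [exact: ltW | rewrite mulnC leq_divM].
move: hs; rewrite -(ler_nat R) natrM natrX => /le_trans; apply.
have Nk : (N <= m * (k %/ m).+1)%N.
  by rewrite (leq_trans (ltnW kN')) // (leq_trans (leqnSn _)) // leq_pmull.
have mk0 : (0 < m * (k %/ m).+1)%N by rewrite muln_gt0 m0.
have sb := entropy_rate_lt mk0 (hN _ Nk) sep.
apply: (le_trans (ler_wpM2r _ sb)); first by rewrite exprn_ge0.
rewrite -[X in _ <= X ^+ _](@lnK _ mu) ?posrE // -expRM_natl.
have -> : (m * (k %/ m).+1)%:R * ln mu =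
    (m * (k %/ m).+1)%:R * y + (k %/ m).+1%:R * (m%:R * (ln mu - y)).
  by rewrite natrM; lra.
rewrite expRD ler_pM2l ?expR_gt0 // [in X in _ <= X]expRM_natl.
by apply: lerXn2r; rewrite ?nnegrE ?expR_ge0.
Qed.

End EntropyCuts.

(** * Kneading orbits and the recursion for cut points *)

(** The orbit of the turning point under a tent map of slope [z], with the
    branches prescribed by [e] (true for the left one) instead of being read
    off the order, so that it makes sense at every Galois conjugate. *)
Fixpoint kneading_orbit (A : nzRingType) (z : A) (e : nat -> bool) (k : nat) : A :=
  if k is j.+1 then 1 - (-1) ^+ e j * (z * kneading_orbit z e j) else 0.

Section Growth.
Variable R : realType.

Lemma bernoulli (x : R) n : 0 <= x -> 1 + n%:R * x <= (1 + x) ^+ n.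
Proof.
move=> x0; elim: n => [|n IH]; first by rewrite expr0; lra.
rewrite exprS -natr1; have n0 : 0 <= n%:R :> R by [].
apply: (@le_trans _ _ ((1 + x) * (1 + n%:R * x))); first by nra.
by apply: ler_wpM2l => //; lra.
Qed.

(** A sequence of subexponential growth cannot stay above a fixed proportion of
    its own partial sums. *)
Lemma small_next_term (u : nat -> R) (k0 : R) :
    0 < k0 -> (forall n, 0 <= u n) -> (forall n, (0 < n)%N -> k0 <= u n) ->
    (forall r, 1 < r -> exists C N, forall n, (N <= n)%N -> u n <= C * r ^+ n) ->
  forall d, 0 < d -> exists N, 1 <= d * (\sum_(n < N) u n) /\
                               u N <= d * (\sum_(n < N) u n).
Proof.
move=> k00 u0 uk usub d d0; pose B N := \sum_(n < N) u n.
have BS N : B N.+1 = B N + u N by rewrite /B big_ord_recr.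
apply/not_existsP => h.
have [N0 hN0] : exists N0, 1 <= d * B N0.
  have Bk N : N%:R * k0 <= B N.+1.
    elim: N => [|N IH]; first by rewrite mul0r BS /B big_ord0 add0r.
    by rewrite BS -natr1 mulrDl mul1r lerD // uk.
  have dk : 0 < d * k0 by rewrite mulr_gt0.
  have /truncn_itv/andP[_ hN] : 0 <= (d * k0)^-1 by rewrite invr_ge0 ltW.
  exists (Num.truncn (d * k0)^-1).+2.
  apply: (@le_trans _ _ (d * ((Num.truncn (d * k0)^-1).+1%:R * k0))); last first.
    by rewrite ler_pM2l.
  move: hN; rewrite -[_^-1]div1r ltr_pdivrMr // => hN.
  by rewrite mulrCA ltW.
have Bpos : 0 < B N0.
  by rewrite -(pmulr_rgt0 _ d0); apply: lt_le_trans hN0.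
have Bgrow k : (1 + d) ^+ k * B N0 <= B (N0 + k)%N.
  elim: k => [|k IH]; first by rewrite expr0 mul1r addn0.
  have p1 : 1 <= (1 + d) ^+ k by rewrite exprn_ege1 //; lra.
  have b1 : 1 <= d * B (N0 + k)%N.
    apply: (le_trans hN0); rewrite ler_pM2l //; apply: le_trans IH.
    by rewrite ler_peMl // ltW.
  have u1 : d * B (N0 + k)%N < u (N0 + k)%N.
    by rewrite ltNge; apply/negP => u1; apply: (h (N0 + k)%N).
  rewrite addnS BS exprS -mulrA; apply: (@le_trans _ _ ((1 + d) * B (N0 + k)%N)).
    by rewrite ler_pM2l //; lra.
  by rewrite mulrDl mul1r lerD2l ltW.
have ugrow k : d * ((1 + d) ^+ k * B N0) <= u (N0 + k)%N.
  have : ~ (1 <= d * B (N0 + k)%N /\ u (N0 + k)%N <= d * B (N0 + k)%N) by exact: h.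
  have b1 : 1 <= d * B (N0 + k)%N.
    apply: (le_trans hN0); rewrite ler_pM2l //; apply: le_trans (Bgrow k).
    by rewrite ler_peMl ?(ltW Bpos) // exprn_ege1 //; lra.
  move=> hh; have : d * B (N0 + k)%N < u (N0 + k)%N by rewrite ltNge; apply/negP => ?; apply: hh.
  by move/ltW; apply: le_trans; rewrite ler_pM2l.
have r1 : 1 < 1 + d / 2 by lra.
have [C [N1 hC]] := usub _ r1.
pose r := 1 + d / 2; pose x := d / 2 / r.
have r0 : 0 < r by rewrite /r; lra.
have x0 : 0 < x by rewrite !divr_gt0.
have rx : r * (1 + x) = 1 + d by rewrite mulrDr mulr1 /x [r * (_ / r)]mulrC divfK ?gt_eqF // /r; lra.
pose M := C * r ^+ N0 / (d * B N0).
have bound k : (N1 <= k)%N -> (1 + x) ^+ k <= M.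
  move=> Nk; rewrite ler_pdivlMr ?mulr_gt0 // -(ler_pM2l (exprn_gt0 k r0)).
  have := le_trans (ugrow k) (hC (N0 + k)%N (leq_trans Nk (leq_addl _ _))).
  rewrite -rx exprMn exprD -/r.
  by move: ((1 + x) ^+ k) (r ^+ k) (r ^+ N0) (B N0) => *; lra.
have {}bound k : (N1 <= k)%N -> k%:R <= (M - 1) / x.
  move=> /bound h1; have h2 := bernoulli k (ltW x0).
  by rewrite ler_pdivlMr // lerBrDl; apply: le_trans h1.
have M0 : 0 <= (M - 1) / x by apply: le_trans (bound N1 _).
have /truncn_itv/andP[_ hM] := M0.
have := bound (maxn N1 (Num.truncn ((M - 1) / x)).+1) (leq_maxl _ _).
apply/negP; rewrite -ltNge; apply: (lt_le_trans hM).
by rewrite ler_nat leq_maxr.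
Qed.

Lemma geo_sum_le (w : R) N : 0 <= w < 1 -> \sum_(n < N) w ^+ n <= (1 - w)^-1.
Proof.
move=> /andP[w0 w1]; have w' : 0 < 1 - w by lra.
rewrite -[X in _ <= X]div1r ler_pdivlMr // mulrC -opprB mulNr.
by rewrite -subrX1 opprB gerBl exprn_ge0.
Qed.

Lemma wsum_shift_le (w : R) (e v : nat -> R) N : 0 <= w -> (forall n, 0 <= e n) ->
    e 0%N = 0 -> (forall n, e n.+1 <= v n) ->
  \sum_(n < N) e n * w ^+ n <= w * \sum_(n < N) v n * w ^+ n.
Proof.
move=> w0 e0 e00 ev; apply: (@le_trans _ _ (\sum_(n < N.+1) e n * w ^+ n)).
  by rewrite big_ord_recr lerDl mulr_ge0 ?exprn_ge0.
rewrite big_ord_recl /= e00 mul0r add0r mulr_sumr; apply: ler_sum => n _.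
rewrite /bump leq0n add1n exprS mulrCA; apply: ler_wpM2l => //.
by apply: ler_wpM2r; rewrite ?exprn_ge0.
Qed.

End Growth.

Section Recursion.
Variables (R : realType) (a b c : R) (f : R -> R).
Hypothesis pf : peaked a b c f.

Local Notation Q := (cuts a b c f).
Local Notation I x := (a <= x <= b).

Definition open_count n (x y : R) : nat := count (fun q => (x < q < y)%R) (Q n).

(** Up to normalisation and a limit in [n], the coordinate in which [f] becomes
    a tent map with turning point 0. *)
Definition signed_count n (x : R) : R :=
  if c <= x then (open_count n c x)%:R else - (open_count n x c)%:R.

Lemma open_count_split n x y z : x <= y -> y <= z ->
  (open_count n x y + open_count n y z <= open_count n x z
   <= open_count n x y + open_count n y z + 1)%N.
Proof.
move=> xy yz; rewrite /open_count; apply/andP; split.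
  rewrite -count_predUI [X in (_ + X)%N](_ : _ = 0%N) ?addn0.
    by apply: sub_count => q /= /orP[] /andP[h1 h2]; apply/andP; split; lra.
  apply/eqP; rewrite -leqn0 leqNgt -has_count; apply/hasPn => q _ /=.
  by apply/negP => /andP[] /andP[h1 h2] /andP[h3 h4]; lra.
have c1 : (count (pred1 y) (Q n) <= 1)%N.
  by rewrite count_uniq_mem ?cuts_uniq // leq_b1.
apply: (@leq_trans (count (fun q => (x < q < y)%R) (Q n) +
  count (fun q => (y < q < z)%R) (Q n) + count (pred1 y) (Q n))); last by rewrite leq_add2l.
rewrite -count_predUI -addnA addnC -addnA (leq_trans _ (leq_addl _ _)) //.
rewrite addnC -count_predUI (leq_trans _ (leq_addr _ _)) //.
apply: sub_count => q /= /andP[h1 h2].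
by case: (ltgtP q y) => h; rewrite ?h1 ?h2 ?orbT.
Qed.

Lemma signed_count_diff n u v : u <= v ->
  `|(open_count n u v)%:R - (signed_count n v - signed_count n u)| <= 1.
Proof.
move=> uv; rewrite /signed_count.
have spl x y z : x <= y -> y <= z ->
  `|(open_count n x z)%:R - ((open_count n x y)%:R + (open_count n y z)%:R)| <= 1 :> R.
  move=> xy yz; have /andP[] := open_count_split n xy yz.
  by rewrite -2!(ler_nat R) !natrD => *; rewrite ler_norml; apply/andP; split; lra.
case: (leP c u) => cu.
  rewrite (le_trans cu uv).
  by move: (spl c u v cu uv); rewrite !ler_norml => /andP[? ?]; apply/andP; split; lra.
case: (leP c v) => cv.
  by move: (spl u c v (ltW cu) cv); rewrite !ler_norml => /andP[? ?]; apply/andP; split; lra.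
by move: (spl u v c uv (ltW cv)); rewrite !ler_norml => /andP[? ?]; apply/andP; split; lra.
Qed.

Lemma signed_count0 x : signed_count 0 x = 0.
Proof. by rewrite /signed_count /open_count (cuts0 pf) /= oppr0 if_same. Qed.

Lemma signed_count_c n : signed_count n c = 0.
Proof.
rewrite /signed_count lexx /open_count.
rewrite (eq_count (a2 := pred0)) ?count_pred0 // => q /=.
by case: ltgtP.
Qed.

Lemma signed_count_le n x : `|signed_count n x| <= (size (Q n))%:R.
Proof.
by rewrite /signed_count; case: ifP => _; rewrite ?normrN normr_nat ler_nat count_size.
Qed.

Lemma sign_signed_count n (x : R) :
  (-1) ^+ (x < c)%R * signed_count n x =
  (if (c <= x)%R then open_count n c x else open_count n x c)%:R.
Proof.
rewrite /signed_count ltNge; case: (c <= x) => /=; first by rewrite expr0 mul1r.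
by rewrite expr1 mulN1r opprK.
Qed.

(** [f] maps the interval between [c] and [x] bijectively onto the one between
    [f x] and the peak value. *)
Lemma open_count_step n x : I x ->
  (if c <= x then open_count n.+1 c x else open_count n.+1 x c) =
  open_count n (f x) (f c).
Proof.
move=> Ix; have Ic := peaked_c pf; move: (Ix) (Ic) => /andP[ax xb] /andP[ac cb].
have key u v : ((c <= x) && (u == c) && (v == x)) || ((x < c) && (u == x) && (v == c)) ->
    open_count n.+1 u v = open_count n (f x) (f c).
  move=> uvE.
  have h : (c <= x /\ u = c /\ v = x) \/ (x < c /\ u = x /\ v = c).
    by case/orP: uvE => /andP[/andP[? /eqP-> /eqP->]]; [left|right].
  have fcomp y z : u <= y -> y < z -> z <= v ->
      (c <= x -> f z < f y) /\ (x < c -> f y < f z).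
    move=> uy yz zv; split=> cx.
      by apply: (peaked_dec pf) => //; case: h => -[? [? ?]]; subst; lra.
    by apply: (peaked_inc pf) => //; case: h => -[? [? ?]]; subst; lra.
  have uv : u <= v by case: h => -[? [-> ->]] //; exact: ltW.
  apply/eqP; rewrite eqn_leq /open_count; apply/andP; split.
    apply: (count_le_inj (g := f)); first exact: cuts_uniq.
      move=> q; rewrite (cutsS pf) => /orP[/eqP->|/andP[_ ->]] /andP[uq qv] /=.
        by case: h => -[? [? ?]]; subst; rewrite ltxx in uq qv.
      have [h1 h1'] := fcomp u q (lexx _) uq (ltW qv).
      have [h2 h2'] := fcomp q v (ltW uq) qv (lexx _).
      case: h => -[cx [? ?]]; subst; first by rewrite h1 ?h2.
      by rewrite h1' ?h2'.
    move=> y z; rewrite !inE => /andP[_ /andP[uy yv]] /andP[_ /andP[uz zv]] e.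
    case: (ltgtP y z) => // yz.
      have [h1 h2] := fcomp y z (ltW uy) yz (ltW zv).
      by case: (leP c x) => [/h1|/h2]; rewrite e ltxx.
    have [h1 h2] := fcomp z y (ltW uz) yz (ltW yv).
    by case: (leP c x) => [/h1|/h2]; rewrite e ltxx.
  rewrite -!size_filter -[X in (_ <= X)%N](size_map f); apply: uniq_leq_size.
    by rewrite filter_uniq // cuts_uniq.
  move=> y; rewrite mem_filter => /andP[/andP[y1 y2] yQ].
  have [] := @peaked_ivt _ _ _ _ _ pf u v y _ _ uv.
  - by case: h => -[? [-> _]].
  - by case: h => -[? [_ ->]].
  - by rewrite ge_min le_max; case: h => -[? [-> ->]]; rewrite !(ltW y1) !(ltW y2) !orbT.
  move=> q /andP[uq qv] fq; apply/mapP; exists q => //.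
  rewrite mem_filter; apply/andP; split.
    by rewrite !lt_neqAle uq qv !andbT; case: h => -[? [? ?]]; subst;
      apply/andP; split; apply/eqP => ?; subst; rewrite ltxx in y1 y2.
  rewrite (cutsS pf) fq yQ andbT; apply/orP; right.
  by case: h => -[? [? ?]]; subst; apply/andP; split; lra.
case: (leP c x) => cx; first by apply: key; rewrite cx !eqxx.
by apply: key; rewrite cx !eqxx orbT.
Qed.

(** The error 1 accounts for [c] and the endpoints, which open intervals omit. *)
Lemma signed_count_step n (x : R) : I x ->
  `|(-1) ^+ (x < c)%R * signed_count n.+1 x - (signed_count n (f c) - signed_count n (f x))| <= 1.
Proof.
move=> Ix; rewrite sign_signed_count (open_count_step n Ix).
exact/signed_count_diff/(peaked_le_peak pf).
Qed.

Definition left_count n : nat := count (fun q => (q < c)%R) (Q n).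
Definition right_count n : nat := count (fun q => (c < q)%R) (Q n).

Lemma count_below_peak n :
  (count (fun q => (q <= f c)%R) (Q n) <= left_count n + open_count n c (f c) + 2)%N.
Proof.
have c1 y : (count (pred1 y) (Q n) <= 1)%N.
  by rewrite count_uniq_mem ?cuts_uniq // leq_b1.
apply: (@leq_trans (left_count n + open_count n c (f c) + (count (pred1 c) (Q n) +
   count (pred1 (f c)) (Q n)))%N); last by rewrite leq_add2l (leq_add (c1 _) (c1 _)).
have U (A B : pred R) : (count (predU A B) (Q n) <= count A (Q n) + count B (Q n))%N.
  by rewrite -count_predUI leq_addr.
apply: leq_trans (leq_add (U _ _) (U _ _)); apply: leq_trans (U _ _).
apply: sub_count => q /= qf.
by case: (ltgtP q c) => //= h; case: (ltgtP q (f c)) qf => //= ->; rewrite ?orbT.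
Qed.

(** [f] is injective on each side of [c], and all its values are below [f c]. *)
Lemma side_count_step (P : pred R) n :
    (forall x, P x -> x != c) ->
    {in [pred x | I x && P x] &, injective f} ->
  (count P (Q n.+1) <= left_count n + open_count n c (f c) + 2)%N.
Proof.
move=> Pc Pinj; apply: leq_trans (count_below_peak n).
apply: (count_le_inj (g := f)); first exact: cuts_uniq.
  move=> x; rewrite (cutsS pf) => /orP[/eqP->|/andP[Ix ->]] Px.
    by have := Pc _ Px; rewrite eqxx.
  exact: peaked_le_peak pf _ Ix.
by move=> x y; rewrite !inE => /andP[/(cuts_itv pf) Ix Px] /andP[/(cuts_itv pf) Iy Py];
  apply: Pinj; rewrite inE ?Ix ?Iy.
Qed.

Lemma left_count_step n : (left_count n.+1 <= left_count n + open_count n c (f c) + 2)%N.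
Proof.
apply: side_count_step => [x /lt_eqF->//|x y].
rewrite !inE => /andP[/andP[ax _] xc] /andP[/andP[ay _] yc] e.
case: (ltgtP x y) => // h.
  by have := peaked_inc pf ax h (ltW yc); rewrite e ltxx.
by have := peaked_inc pf ay h (ltW xc); rewrite e ltxx.
Qed.

Lemma right_count_step n : (right_count n.+1 <= left_count n + open_count n c (f c) + 2)%N.
Proof.
apply: side_count_step => [x /gt_eqF->//|x y].
rewrite !inE => /andP[/andP[_ xb] xc] /andP[/andP[_ yb] yc] e.
case: (ltgtP x y) => // h.
  by have := peaked_dec pf (ltW xc) h yb; rewrite e ltxx.
by have := peaked_dec pf (ltW yc) h xb; rewrite e ltxx.
Qed.

Lemma size_cuts_sides n : (size (Q n) <= left_count n + right_count n + 1)%N.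
Proof.
have c1 y : (count (pred1 y) (Q n) <= 1)%N.
  by rewrite count_uniq_mem ?cuts_uniq // leq_b1.
have U (A B : pred R) : (count (predU A B) (Q n) <= count A (Q n) + count B (Q n))%N.
  by rewrite -count_predUI leq_addr.
apply: leq_trans (leq_add (U _ _) (c1 c)); apply: leq_trans (U _ _).
rewrite -count_predT; apply: sub_count => q _ /=.
by case: ltgtP.
Qed.

End Recursion.

(** * The kneading orbit at the growth rate is periodic *)

(** The recursion determines its solution from the initial value, so approximate
    solutions converge to the exact one and pass on their signs and zeros. *)
Lemma kneading_orbit_limit (R : realType) (z : R) (e : nat -> bool) (p : nat) :
    (forall eta, 0 < eta -> exists y : nat -> R,
      [/\ y 0%N = 0, y p = 0,
       forall k, `|y k.+1 - (1 - (-1) ^+ e k * (z * y k))| <= eta &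
       forall k, 0 <= (-1) ^+ e k * y k]) ->
  kneading_orbit z e p = 0 /\ forall k, 0 <= (-1) ^+ e k * kneading_orbit z e k.
Proof.
move=> approx.
pose C := fix C k : R := if k is j.+1 then 1 + `|z| * C j else 0.
have C0 k : 0 <= C k by elim: k => //= k IH; rewrite addr_ge0 // mulr_ge0.
have close eta y : [/\ y 0%N = 0, y p = 0,
       forall k, `|y k.+1 - (1 - (-1) ^+ e k * (z * y k))| <= eta &
       forall k, 0 <= (-1) ^+ e k * y k] ->
    forall k, `|y k - kneading_orbit z e k| <= C k * eta.
  move=> [y0 _ step _]; elim=> [|k IH] /=; first by rewrite y0 subrr normr0 mul0r.
  have -> : y k.+1 - (1 - (-1) ^+ e k * (z * kneading_orbit z e k)) =
     (y k.+1 - (1 - (-1) ^+ e k * (z * y k))) -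
      (-1) ^+ e k * (z * (y k - kneading_orbit z e k)) by ring.
  apply: (le_trans (ler_normB _ _)); rewrite mulrDl mul1r lerD //.
  by rewrite normrMsign normrM -mulrA ler_wpM2l.
have small x k : (forall eta, 0 < eta -> x <= C k * eta) -> x <= 0.
  move=> h; rewrite leNgt; apply/negP => x0.
  have C1 : 0 < C k + 1 by have := C0 k; lra.
  have := h (x / (2 * (C k + 1))) (ltac:(by rewrite divr_gt0 // mulr_gt0)).
  rewrite mulrA ler_pdivlMr ?mulr_gt0 //; have := C0 k; nra.
split.
  apply/eqP; rewrite -normr_le0; apply: (small _ p) => eta /approx[y hy].
  by have := close eta y hy p; case: hy => _ -> _ _; rewrite sub0r normrN.
move=> k; rewrite -oppr_le0; apply: (small _ k) => eta /approx[y hy].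
have := close eta y hy k; case: hy => _ _ _ /(_ k) sy.
rewrite -(normrMsign (e k)) mulrBr ler_norml => /andP[h1 h2].
move: sy h1 h2; move: (_ * y k) (_ * kneading_orbit z e k) => u v *; lra.
Qed.

Lemma cuts_growth_ge (R : realType) (a b c : R) (f : R -> R) (lam : R) m :
    peaked a b c f -> 1 < lam -> h_top `[a, b] f = (ln lam)%:E -> (0 < m)%N ->
  lam ^+ m <= (size (cuts a b c f m))%:R + 1.
Proof.
move=> pf lam1 hE m0; have := h_top_le_cuts pf m0; rewrite hE lee_fin.
have l0 : 0 < lam := lt_trans ltr01 lam1.
rewrite ler_pdivlMr ?ltr0n // mulr_natr -lnXn //.
by rewrite ler_ln ?posrE ?exprn_gt0 ?ltr0n // natr1.
Qed.

Section KneadingRoot.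
Variables (R : realType) (a b c : R) (f : R -> R).
Hypothesis pf : peaked a b c f.
Variables (p : nat) (lam : R).
Hypotheses (cp : iter p f c = c) (lam1 : 1 < lam).

Local Notation Q := (cuts a b c f).
Local Notation q n := ((size (Q n))%:R : R).
Local Notation d := (signed_count a b c f).

Hypothesis growth_ge : forall m, (0 < m)%N -> lam ^+ m <= q m + 1.
Hypothesis growth_le : forall mu, lam < mu ->
  exists C N, forall n, (N <= n)%N -> q n <= C * mu ^+ n.

Let w := lam^-1.

Let lam0 : 0 < lam. Proof. exact: lt_trans ltr01 lam1. Qed.

Let w01 : 0 < w < 1. Proof. by rewrite /w invr_gt0 lam0 invf_lt1. Qed.

Let wlam : w * lam = 1. Proof. by rewrite mulVf // gt_eqF. Qed.

Lemma weighted_cuts_ge n : (0 < n)%N -> 1 - w <= q n * w ^+ n.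
Proof.
move=> n0; have := growth_ge n0; have /andP[w0 w1] := w01.
have wn : 0 < w ^+ n by rewrite exprn_gt0.
rewrite -(ler_pM2l wn) -exprMn wlam expr1n mulrDr mulr1 mulrC => h.
have : w ^+ n <= w by rewrite -(prednK n0) exprS ler_piMr ?exprn_ile1 ?ltW.
by lra.
Qed.

Lemma weighted_cuts_le r : 1 < r ->
  exists C N, forall n, (N <= n)%N -> q n * w ^+ n <= C * r ^+ n.
Proof.
move=> r1; have /andP[w0 w1] := w01.
have [|C [N hN]] := @growth_le (lam * r); first by rewrite ltr_pMr.
exists C, N => n /hN h.
apply: (le_trans (ler_wpM2r (exprn_ge0 n (ltW w0)) h)).
by rewrite -mulrA -exprMn mulrAC [lam * _]mulrC wlam mul1r.
Qed.

Let B N : R := \sum_(n < N) q n * w ^+ n.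
Let G N : R := \sum_(n < N) (open_count a b c f n c (f c))%:R * w ^+ n.
Let s := (1 - w)^-1.

(** Cut points outside the interval from [c] to [f c] come from the left side of
    [c] by the recursions [left_count_step] and [right_count_step]; after
    weighting, each step costs a factor [w < 1], so these points are dominated
    by those inside.  Hence [G] may serve as normalisation. *)
Lemma peak_carries_mass N : B N <= (2 * s + 1) * (G N + 2 * s) + s.
Proof.
have /andP[w0 w1] := w01.
pose E := \sum_(n < N) (left_count a b c f n)%:R * w ^+ n.
pose D := \sum_(n < N) (right_count a b c f n)%:R * w ^+ n.
pose S := \sum_(n < N) w ^+ n.
have S1 : S <= s by apply: geo_sum_le; rewrite w1 ltW.
have S0 : 0 <= S by apply: sumr_ge0 => n _; rewrite exprn_ge0 // ltW.
have G0 : 0 <= G N by apply: sumr_ge0 => n _; rewrite mulr_ge0 // exprn_ge0 // ltW.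
have sumE : \sum_(n < N) ((left_count a b c f n)%:R + (open_count a b c f n c (f c))%:R + 2)
    * w ^+ n = E + G N + 2 * S.
  by rewrite mulr_sumr -!big_split; apply: eq_bigr => n _ /=; rewrite !mulrDl.
have c0 : left_count a b c f 0 = 0%N by rewrite /left_count (cuts0 pf).
have c0' : right_count a b c f 0 = 0%N by rewrite /right_count (cuts0 pf).
have EN : E <= w * (E + G N + 2 * S).
  rewrite -sumE; apply: (wsum_shift_le (e := fun n => (left_count a b c f n)%:R)
   (v := fun n => (left_count a b c f n)%:R + (open_count a b c f n c (f c))%:R + 2)).
  - exact: ltW.
  - by [].
  - by rewrite c0.
  - by move=> n; rewrite -!natrD ler_nat (left_count_step pf).
have DN : D <= w * (E + G N + 2 * S).
  rewrite -sumE; apply: (wsum_shift_le (e := fun n => (right_count a b c f n)%:R)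
   (v := fun n => (left_count a b c f n)%:R + (open_count a b c f n c (f c))%:R + 2)).
  - exact: ltW.
  - by [].
  - by rewrite c0'.
  - by move=> n; rewrite -!natrD ler_nat (right_count_step pf).
have BN : B N <= E + D + S.
  rewrite -!big_split; apply: ler_sum => n _ /=; rewrite -!mulrDl -[X in _ <= _ + X]mul1r.
  rewrite -mulrDl; apply: ler_wpM2r; first by rewrite exprn_ge0 // ltW.
  by rewrite -natrD natr1 ler_nat -addn1 size_cuts_sides.
have s1 : s * (1 - w) = 1 by rewrite /s mulVf // gt_eqF // subr_gt0.
have s0 : 0 < s by rewrite /s invr_gt0 subr_gt0.
have E1 : E <= s * (G N + 2 * s).
  rewrite -(ler_pM2r (_ : 0 < 1 - w)) ?subr_gt0 // mulrAC s1 mul1r; nra.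
have E0 : 0 <= E by apply: sumr_ge0 => n _; rewrite mulr_ge0 // exprn_ge0 // ltW.
have D1 : D <= E + G N + 2 * s by nra.
lra.
Qed.

(** The recursion for the weighted sums up to [N] has two errors: the bounded ones
    of [signed_count_step], which sum to at most [s], and the boundary term at
    [n = N]. *)
Lemma approximate_kneading_orbit eta : 0 < eta ->
  exists y : nat -> R,
      [/\ y 0%N = 0, y p = 0,
       forall k, `|y k.+1 - (1 - (-1) ^+ (iter k f c < c)%R * (lam * y k))| <= eta &
       forall k, 0 <= (-1) ^+ (iter k f c < c)%R * y k].
Proof.
move=> eta0; have /andP[w0 w1] := w01.
have s0 : 0 < s by rewrite /s invr_gt0 subr_gt0.
pose M := 2 * (2 * s + 1).
have M0 : 0 < M by rewrite /M; lra.
pose m0 := 2 * (s + (2 * s + 1) * (2 * s)).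
have m00 : 0 < m0 by rewrite /m0; nra.
(* [t] makes both errors at most [eta * G N]; [m0 <= B N] lets [M * G N] bound
   the total mass. *)
pose t := Num.min (m0^-1) (eta / ((s + lam) * M)).
have t0 : 0 < t by rewrite lt_min invr_gt0 m00 divr_gt0 // mulr_gt0 // addr_gt0.
have q0 n : 0 <= q n * w ^+ n by rewrite mulr_ge0 // exprn_ge0 // ltW.
have k00 : 0 < 1 - w by rewrite subr_gt0.
have [N [hN1 hN2]] := small_next_term k00 q0 weighted_cuts_ge weighted_cuts_le t0.
rewrite -/(B N) in hN1 hN2.
have B0 : 0 < B N by rewrite -(pmulr_rgt0 _ t0) (lt_le_trans ltr01).
have BG : B N <= M * G N.
  have Bm : m0 <= B N.
    have : t <= m0^-1 by rewrite ge_min lexx.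
    rewrite -(ler_pM2r B0) => /(le_trans hN1).
    by rewrite mulrC ler_pdivlMr // mul1r.
  have := peak_carries_mass N; move: Bm; rewrite /M /m0; lra.
have G0 : 0 < G N by rewrite -(pmulr_rgt0 _ M0) (lt_le_trans B0).
(* Otherwise no cut point lies between [c] and [f c]. *)
have cfc : c <= f c.
  rewrite leNgt; apply/negP => fcc.
  suff : G N = 0 by move=> G00; rewrite G00 ltxx in G0.
  apply: big1 => n _; rewrite /open_count (eq_count (a2 := pred0)) ?count_pred0 ?mul0r //.
  by move=> x /=; apply/negP => /andP[? ?]; lra.
pose D x := \sum_(n < N) d n x * w ^+ n.
have DG : D (f c) = G N by apply: eq_bigr => n _; rewrite /signed_count cfc.
have Ic := peaked_c pf.
have bound x : a <= x <= b ->
    `|D (f x) - (G N - (-1) ^+ (x < c)%R * (lam * D x))| <= eta * G N.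
  move=> Ix.
  have shift : w * \sum_(n < N) d n.+1 x * w ^+ n = D x + d N x * w ^+ N.
    rewrite /D -(big_ord_recr N (fun n => d n x * w ^+ n)) big_ord_recl /=.
    rewrite (signed_count0 pf) mul0r add0r mulr_sumr; apply: eq_bigr => n _.
    by rewrite /bump leq0n add1n exprS mulrCA.
  have {}shift : \sum_(n < N) d n.+1 x * w ^+ n = lam * (D x + d N x * w ^+ N).
    by rewrite -shift mulrA [lam * w]mulrC wlam mul1r.
  have err : `|\sum_(n < N) ((-1) ^+ (x < c)%R * d n.+1 x - (d n (f c) - d n (f x))) * w ^+ n| <= s.
    apply: (le_trans (ler_norm_sum _ _ _)).
    apply: (@le_trans _ _ (\sum_(n < N) w ^+ n)); last first.
      by apply: geo_sum_le; rewrite w1 ltW.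
    apply: ler_sum => n _; rewrite normrM (ger0_norm (exprn_ge0 n (ltW w0))).
    by rewrite ler_piMl ?exprn_ge0 ?(ltW w0) // signed_count_step.
  have errE : \sum_(n < N) ((-1) ^+ (x < c)%R * d n.+1 x - (d n (f c) - d n (f x))) * w ^+ n
    = (-1) ^+ (x < c)%R * (lam * (D x + d N x * w ^+ N)) - (G N - D (f x)).
    rewrite -DG -shift /D mulr_sumr -!sumrB; apply: eq_bigr => n _.
    by rewrite mulrBl mulrBl mulrA.
  rewrite errE in err.
  have -> : D (f x) - (G N - (-1) ^+ (x < c)%R * (lam * D x)) =
    ((-1) ^+ (x < c)%R * (lam * (D x + d N x * w ^+ N)) - (G N - D (f x)))
     - (-1) ^+ (x < c)%R * (lam * (d N x * w ^+ N)) by ring.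
  apply: (le_trans (ler_normB _ _)).
  apply: (@le_trans _ _ (s + lam * (t * B N))).
    apply: lerD => //; rewrite normrMsign normrM gtr0_norm // ler_pM2l //.
    apply: le_trans hN2; rewrite normrM (ger0_norm (exprn_ge0 N (ltW w0))).
    by apply: ler_wpM2r; rewrite ?exprn_ge0 ?(ltW w0) // signed_count_le.
  apply: (@le_trans _ _ ((s + lam) * (t * B N))).
    by rewrite mulrDl lerD2r ler_peMr // ltW.
  have tt : t <= eta / ((s + lam) * M) by rewrite ge_min lexx orbT.
  apply: (@le_trans _ _ ((s + lam) * (eta / ((s + lam) * M) * (M * G N)))).
    rewrite ler_pM2l ?addr_gt0 //; apply: ler_pM => //; exact: ltW.
  rewrite le_eqVlt; apply/orP; left; apply/eqP; field.
  by rewrite !gt_eqF // addr_gt0.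
exists (fun k => D (iter k f c) / G N); split.
- by rewrite /= /D big1 ?mul0r // => n _; rewrite signed_count_c mul0r.
- by rewrite /= cp /D big1 ?mul0r // => n _; rewrite signed_count_c mul0r.
- move=> k /=; set u := D (f _); set v := D _.
  have -> : u / G N - (1 - (-1) ^+ (iter k f c < c)%R * (lam * (v / G N))) =
    (u - (G N - (-1) ^+ (iter k f c < c)%R * (lam * v))) / G N.
    by field; rewrite gt_eqF.
  rewrite normf_div (gtr0_norm G0) ler_pdivrMr //.
  exact: bound (peaked_iter pf k Ic).
- move=> k; rewrite mulrA divr_ge0 ?(ltW G0) // /D mulr_sumr.
  apply: sumr_ge0 => n _; rewrite mulrA sign_signed_count.
  by rewrite mulr_ge0 // exprn_ge0 // ltW.
Qed.

Lemma growth_kneading_root : let e k := (iter k f c < c)%R in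
  kneading_orbit lam e p = 0 /\ forall k, 0 <= (-1) ^+ e k * kneading_orbit lam e k.
Proof. exact/kneading_orbit_limit/approximate_kneading_orbit. Qed.

End KneadingRoot.

(** The weighted counts of cut points realise the Milnor-Thurston semiconjugacy
    from [f] to the tent map of slope [lam] along the critical orbit, which
    therefore closes up for the tent map as well. *)
Lemma kneading_root (R : realType) (a b c lam : R) (f : R -> R) (p : nat) :
    peaked a b c f -> iter p f c = c -> 1 < lam -> lam%:E = expeR (h_top `[a, b] f) ->
  let e k := (iter k f c < c)%R in
  kneading_orbit lam e p = 0 /\ forall k, 0 <= (-1) ^+ e k * kneading_orbit lam e k.
Proof.
move=> pf cp lam1 lamE.
have hE : h_top `[a, b] f = (ln lam)%:E.
  case: (h_top _ f) lamE => [r| |] //=; first by move=> [->]; rewrite expRK.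
  by move=> [h]; move: lam1; rewrite h ltr10.
apply: (growth_kneading_root pf cp lam1) => [m|mu hmu].
  exact: cuts_growth_ge.
apply: (cuts_growth_le pf); first exact: lt_trans hmu.
by rewrite hE lte_fin ltr_ln ?posrE ?(lt_trans ltr01) // (lt_trans lam1).
Qed.

(** * Minimum and maximum turning points *)

Section Reflection.
Variables (R : realType) (a b : R) (f : R -> R).

Definition flip (g : R -> R) (x : R) : R := - g (- x).

Lemma iter_flip g n x : iter n (flip g) x = - iter n g (- x).
Proof. by elim: n => [|n IH] /=; rewrite ?opprK // IH /flip opprK. Qed.

Lemma separated_flip g (x y : R) n e s : separated `[x, y] g n e s ->
  separated `[- y, - x] (flip g) n e (map -%R s).
Proof.
move=> [us sI sep]; split.
- by rewrite map_inj_uniq //; exact: oppr_inj.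
- by move=> _ /mapP[z /sI /= + ->]; rewrite !in_itv /= !lerN2 andbC.
- move=> _ _ /mapP[u us' ->] /mapP[v vs ->]; rewrite eqr_opp => uv.
  have [k kn ke] := sep u v us' vs uv; exists k => //.
  by rewrite !iter_flip !opprK addrC distrC.
Qed.

Lemma flipK g : flip (flip g) = g.
Proof. by apply/funext => x; rewrite /flip !opprK. Qed.

Lemma max_separated_flip n e :
  max_separated `[- b, - a] (flip f) n e = max_separated `[a, b] f n e.
Proof.
congr ereal_sup; apply/seteqP; split=> _ [s hs <-]; exists (map -%R s); rewrite ?size_map //.
  by have := separated_flip hs; rewrite flipK !opprK.
exact: separated_flip.
Qed.

Lemma h_top_flip : h_top `[- b, - a] (flip f) = h_top `[a, b] f.
Proof.
rewrite !h_topE; congr ereal_sup; apply: eq_imagel => e _.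
by congr limn_esup; apply/funext => n; rewrite max_separated_flip.
Qed.

End Reflection.

Lemma unimodal_peaked (R : realType) (a b c : R) (f : R -> R) p :
    unimodal a b c f -> iter p f c = c ->
  exists a' b' c' f', [/\ peaked a' b' c' f', iter p f' c' = c' &
    h_top `[a', b'] f' = h_top `[a, b] f].
Proof.
move=> [acb fc fI [[inc dec]|[dec inc]]] cp; first by exists a, b, c, f.
exists (- b), (- a), (- c), (flip f); split; last exact: h_top_flip; last first.
  by rewrite iter_flip opprK cp.
split.
- by case/andP: acb => *; apply/andP; split; lra.
- apply/subspace_continuousP => x /=; rewrite in_itv /= => /andP[bx xa].
  apply: cvgN; move/subspace_continuousP: fc => /(_ (- x)) fc.
  have /fc {}fc : [set` `[a, b]] (- x) by rewrite /= in_itv /=; apply/andP; split; lra.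
  apply: cvg_comp fc => A /= hA.
  have : nbhs x (-%R @^-1` [set y | [set` `[a, b]] y -> A y]).
    by apply: (@oppr_continuous _ R^o x).
  apply: filterS => y /= hy yab; apply: hy.
  by move: yab; rewrite !in_itv /= => /andP[? ?]; apply/andP; split; lra.
- move=> x /andP[bx xa]; have /andP[? ?] : a <= f (- x) <= b.
    by apply: fI; apply/andP; split; lra.
  by rewrite /flip; apply/andP; split; lra.
- move=> x y; rewrite !in_itv /= => /andP[? ?] /andP[? ?] xy.
  rewrite /flip ltrN2; apply: inc; rewrite ?in_itv /=; first [apply/andP; split; lra|lra].
- move=> x y; rewrite !in_itv /= => /andP[? ?] /andP[? ?] xy.
  rewrite /flip ltrN2; apply: dec; rewrite ?in_itv /=; first [apply/andP; split; lra|lra].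
Qed.

(** * A region free of Galois conjugates *)

Lemma rmorph_kneading_orbit (A B : nzRingType) (phi : {rmorphism A -> B}) z e k :
  phi (kneading_orbit z e k) = kneading_orbit (phi z) e k.
Proof.
by elim: k => [|k IH] /=; rewrite ?rmorph0 // rmorphB rmorph1 !rmorphM rmorphXn rmorphN1 IH.
Qed.

Lemma irreducible_common_root (F : numFieldType) (p q : {poly rat}) (x : F) :
    irreducible_poly p -> root (map_poly ratr p) x -> root (map_poly ratr q) x ->
  p %| q.
Proof.
move=> irr px qx; apply/negPn/negP => pq.
have : coprimep p q by rewrite irreducible_poly_coprime.
rewrite -(coprimep_map (ratr : {rmorphism rat -> F})) => /coprimep_root /(_ px).
by rewrite (rootP qx) eqxx.
Qed.

Lemma root_real_complex (R : realType) (p : {poly rat}) (x : R) :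
  root (map_poly ratr p) x -> root (map_poly ratr p) (x%:C%C : Cplx R).
Proof.
move=> px; rewrite (_ : map_poly ratr p = map_poly (real_complex R) (map_poly ratr p)).
  by rewrite fmorph_root.
by rewrite -map_poly_comp; apply: eq_map_poly => u /=; rewrite fmorph_rat.
Qed.

Lemma galois_conjugate_root (R : realType) (z : Cplx R) (l : R) (q : {poly rat}) :
    galois_conjugate z l -> root (map_poly ratr q) l -> root (map_poly ratr q) z.
Proof.
move=> [p [irr pl pz]] ql.
have := irreducible_common_root irr pl (root_real_complex ql).
by move=> /dvdpP[r ->]; rewrite rmorphM rootM pz orbT.
Qed.

Lemma horner_kneading (F : numFieldType) (x : F) e k :
  (map_poly ratr (kneading_orbit ('X : {poly rat}) e k)).[x] = kneading_orbit x e k.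
Proof.
have c : commr_rmorph (ratr : {rmorphism rat -> F}) x by move=> u; exact: mulrC.
rewrite -[LHS]/(horner_morph c _) rmorph_kneading_orbit.
by rewrite /= horner_morphX.
Qed.

Lemma kneading_conjugate (R : realType) (z : Cplx R) (l : R) e k :
  galois_conjugate z l -> kneading_orbit l e k = 0 -> kneading_orbit z e k = 0.
Proof.
move=> gal h; rewrite -horner_kneading; apply/rootP.
by apply: (galois_conjugate_root gal); apply/rootP; rewrite horner_kneading.
Qed.

(** Below the golden mean the left branch of the tent map takes [1 - l, 0] into
    positive numbers only, so that the turning point has no left preimage in the
    core: the critical orbit returns to it from the right. *)
Lemma last_symbol_right (R : realType) (l : R) (e : nat -> bool) k :
    1 < l -> l ^+ 2 < l + 1 ->
    (forall j, 0 <= (-1) ^+ e j * kneading_orbit l e j) ->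
    kneading_orbit l e k.+1 = 0 ->
  e k = false.
Proof.
move=> l1 lg sgn /=; case ek : (e k) => //; rewrite expr1 mulN1r opprK => h.
have core j : 1 - l <= kneading_orbit l e j <= 1.
  elim: j => [|j /andP[h1 h2]] /=; first by apply/andP; split; lra.
  move: (sgn j); case: (e j); rewrite ?expr1 ?expr0 ?mulN1r ?mul1r => s;
    by apply/andP; split; nra.
by have /andP[h1 _] := core k; nra.
Qed.

Lemma kneading_orbit_bound (F : numFieldType) (z : F) e k : `|z| < 1 ->
  `|kneading_orbit z e k| * (1 - `|z|) <= 1.
Proof.
move=> z1; have z1' : 0 <= 1 - `|z| by rewrite subr_ge0 ltW.
elim: k => [|k IH] /=; first by rewrite normr0 mul0r.
apply: (@le_trans _ _ ((1 + `|z| * `|kneading_orbit z e k|) * (1 - `|z|))).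
  apply: ler_wpM2r => //; apply: (le_trans (ler_normB _ _)).
  by rewrite normr1 normrMsign normrM.
by rewrite mulrDl mul1r -mulrA -[X in _ <= X](subrK `|z|) lerD2l ler_piMr.
Qed.

(** With last symbol R the periodicity equation reads [1 = z * (1 - s * z * x)]
    for a sign [s] and a point [x] of the orbit, and orbits in the unit disk are bounded by
    the geometric series. *)
Lemma conjugate_region (R : realType) (z : Cplx R) (l : R) :
    teapot_pairs (z, l) -> 1 < l -> l ^+ 2 < l + 1 -> `|z| < 1 ->
  `|1 - z| * (1 - `|z|) <= `|z| ^+ 2.
Proof.
move=> [[a [b [c [f [um [p p0 cp] /= lE]]]]] /= gal] l1 lg z1.
have [a' [b' [c' [f' [pf cp' hE]]]]] := unimodal_peaked um cp.
rewrite -hE in lE.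
have [e [root sgn]] : exists e, kneading_orbit l e p = 0 /\
    forall k, 0 <= (-1) ^+ e k * kneading_orbit l e k.
  by eexists; exact: kneading_root pf cp' l1 lE.
case: p p0 cp cp' root => [|[|p]] p0 _ _ root; first by rewrite ltnn in p0.
  by move: root => /= /eqP; rewrite mulr0 mulr0 subr0 oner_eq0.
have ep := last_symbol_right l1 lg sgn root.
have := kneading_conjugate gal root.
rewrite /= ep expr0 mul1r => /eqP; rewrite subr_eq0 => /eqP h.
have -> : 1 - z = - ((-1) ^+ e p * (z ^+ 2 * kneading_orbit z e p)).
  by rewrite {1}h; ring.
rewrite normrN normrMsign normrM normrX -mulrA.
apply: ler_piMr; first exact: exprn_ge0 (normr_ge0 z).
exact: kneading_orbit_bound.
Qed.

(** * A reciprocal kneading polynomial *)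

(** Its largest root is a Salem number; the polynomial is reciprocal, so its
    roots come in pairs [x], [x^-1]. *)
Definition salem_poly : {poly int} := Poly [:: 1; -1; -1; 1; -1; -1; 1].

Definition salem_fun (F : nzRingType) (x : F) : F :=
  1 - x - x ^+ 2 + x ^+ 3 - x ^+ 4 - x ^+ 5 + x ^+ 6.

Lemma unit_int (a b : int) : a * b = 1 -> (a = 1 /\ b = 1) \/ (a = -1 /\ b = -1).
Proof.
move=> ab; have : (`|a| * `|b|)%N == 1%N by rewrite -abszM ab.
rewrite muln_eq1 => /andP[a1 b1]; have [e|e] : a = 1 \/ a = -1 by lia.
  by left; rewrite e mul1r in ab *.
by right; rewrite e mulN1r in ab *; lia.
Qed.

(** The hypotheses say that [salem_poly] is the product of two cubics: the outer
    coefficients are units, and then the others are bounded by 2. *)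
Lemma no_cubic_factors (a0 a1 a2 a3 b0 b1 b2 b3 : int) :
  a0 * b0 = 1 -> a0 * b1 + a1 * b0 = -1 -> a0 * b2 + a1 * b1 + a2 * b0 = -1 ->
  a0 * b3 + a1 * b2 + a2 * b1 + a3 * b0 = 1 ->
  a1 * b3 + a2 * b2 + a3 * b1 = -1 -> a2 * b3 + a3 * b2 = -1 -> a3 * b3 = 1 -> False.
Proof.
move=> e0 e1 e2 e3 e4 e5 e6.
have h1 : -2 <= a1 <= 2 by case: (unit_int e0) => -[? ?]; case: (unit_int e6) => -[? ?]; subst; nia.
have h2 : -2 <= a2 <= 2 by case: (unit_int e0) => -[? ?]; case: (unit_int e6) => -[? ?]; subst; nia.
have c1 : [|| a1 == -2, a1 == -1, a1 == 0, a1 == 1 | a1 == 2] by lia.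
have c2 : [|| a2 == -2, a2 == -1, a2 == 0, a2 == 1 | a2 == 2] by lia.
case: (unit_int e0) => -[? ?]; case: (unit_int e6) => -[? ?]; subst;
case/or4P: c1 => [/eqP?|/eqP?|/eqP?|/orP[/eqP?|/eqP?]];
case/or4P: c2 => [/eqP?|/eqP?|/eqP?|/orP[/eqP?|/eqP?]]; subst; lia.
Qed.

Lemma minimal_polynomial (F : numFieldType) (x : F) (q : {poly rat}) :
    q != 0 -> root (map_poly ratr q) x ->
  exists p : {poly rat}, [/\ irreducible_poly p, root (map_poly ratr p) x &
    forall r : {poly rat}, r != 0 -> root (map_poly ratr r) x -> (size p <= size r)%N].
Proof.
move=> q0 qx.
pose P n := `[< exists2 p : {poly rat}, p != 0 /\ size p = n & root (map_poly ratr p) x >].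
have exP : exists n, P n by exists (size q); apply/asboolP; exists q.
case: (ex_minnP exP) => n /asboolP[p [p0 pn] px] nmin.
have pmin r : r != 0 -> root (map_poly ratr r) x -> (size p <= size r)%N.
  by move=> r0 rx; rewrite pn; apply: nmin; apply/asboolP; exists r.
exists p; split=> //; split.
  rewrite ltnNge; apply/negP => /size1_polyC pc; move: px.
  by rewrite pc map_polyC rootC fmorph_eq0 => /eqP c0; move: p0; rewrite pc c0 eqxx.
move=> r r1 /dvdpP[t pE]; move: (p0); rewrite pE mulf_eq0 negb_or => /andP[t0 r0].
move: px; rewrite pE rmorphM rootM => /orP[tx|rx].
  have := pmin t t0 tx; rewrite pE size_mul // => h.
  by exfalso; move: r1 h; move: r0 t0; rewrite -!size_poly_eq0; move: (size t) (size r) => [|i] [|[|j]] // _ _ _; rewrite !addnS /=; lia.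
have := pmin r r0 rx; rewrite pE => h.
rewrite -dvdp_size_eqp ?dvdp_mulIr // eqn_leq h andbT.
by apply: dvdp_leq; [rewrite mulf_neq0|exact: dvdp_mulIr].
Qed.

Lemma horner_rev (F : fieldType) (r : {poly F}) (x : F) : x != 0 ->
  (\poly_(i < size r) r`_((size r).-1 - i)).[x] = x ^+ (size r).-1 * r.[x^-1].
Proof.
move=> x0; rewrite horner_poly [in RHS]horner_coef mulr_sumr.
rewrite (reindex_inj rev_ord_inj) /=; apply: eq_bigr => i _.
have [i1 i2 i3] : [/\ (i <= (size r).-1)%N, ((size r).-1 - (size r - i.+1))%N = i &
    (size r - i.+1)%N = ((size r).-1 - i)%N].
  have idx (u v : nat) : (u < v)%N ->
      [/\ (u <= v.-1)%N, (v.-1 - (v - u.+1))%N = u & (v - u.+1)%N = (v.-1 - u)%N].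
    by move=> uv; split; lia.
  exact: idx (ltn_ord i).
rewrite i2 mulrCA; congr (_ * _).
by rewrite i3 -[in RHS](subnK i1) exprD exprVn mulfK // expf_neq0.
Qed.

Lemma map_ratr_intr (F : numFieldType) (r : {poly int}) :
  map_poly ratr (map_poly intr r : {poly rat}) = map_poly intr r :> {poly F}.
Proof. by rewrite -map_poly_comp; apply: eq_map_poly => u /=; rewrite ratr_int. Qed.

Lemma horner_salem (F : numFieldType) (x : F) :
  (map_poly ratr (map_poly intr salem_poly : {poly rat})).[x] = salem_fun x.
Proof.
rewrite map_ratr_intr.
rewrite (@horner_coef_wide _ 7); last first.
  by rewrite (leq_trans (size_poly _ _)) // (leq_trans (size_Poly _)).
rewrite !big_ord_recl big_ord0 !coef_map /= !coef_Poly /= /bump /= /salem_fun.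
by rewrite !rmorphN1 !rmorph1; ring.
Qed.

Lemma salem_fun_inv (F : fieldType) (x : F) : x != 0 -> salem_fun x = 0 -> salem_fun x^-1 = 0.
Proof.
move=> x0 px; apply: (mulfI (expf_neq0 6 x0)); rewrite mulr0 -[RHS]px /salem_fun.
by field.
Qed.

(** A rational polynomial of least degree vanishing at [x] either vanishes at
    [x^-1] or leaves to its cofactor in the palindromic [salem_poly] the root
    [x^-1]; the reversed cofactor then vanishes at [x], so that the degree is at
    most three, and small factors are excluded over the integers. *)
Lemma inverse_conjugate (R : realType) (x : R) : 3 / 2 < x < 8 / 5 -> salem_fun x = 0 ->
  galois_conjugate ((x^-1)%:C%C : Cplx R) x.
Proof.
move=> /andP[x1 x2] sx.
have x0 : 0 < x by lra.
have xn0 : x != 0 by rewrite gt_eqF.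
have sP : salem_poly = [:: 1; -1; -1; 1; -1; -1; 1] :> seq int by apply: (@PolyK _ 0).
pose q : {poly rat} := map_poly intr salem_poly.
have szq : size q = 7%N by rewrite size_map_inj_poly ?sP //; exact: intr_inj.
have q0 : q != 0 by rewrite -size_poly_eq0 szq.
have qx : root (map_poly ratr q) x by apply/rootP; rewrite horner_salem.
have [p [irr px pmin]] := minimal_polynomial q0 qx.
exists p; split=> //; first exact: root_real_complex.
apply: root_real_complex; apply/negPn/negP => npx.
have pq := irreducible_common_root irr px qx.
have [p1 [u u0 pE] [r rE]] := dvdpP_rat_int pq.
have rootZ y : root (map_poly ratr p) y = root (map_poly (intr : int -> R) p1) y.
  by rewrite pE linearZ /= rootZ ?fmorph_eq0 // map_ratr_intr.
have p1x : root (map_poly (intr : int -> R) p1) x by rewrite -rootZ.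
have np1x : ~~ root (map_poly (intr : int -> R) p1) x^-1 by rewrite -rootZ.
have szp : size p = size p1.
  by rewrite pE size_scale // size_map_inj_poly //; exact: intr_inj.
have p10 : p1 != 0 by apply: contraNneq np1x => ->; rewrite rmorph0 root0.
have r0 : r != 0 by apply: contra_eq_neq rE => ->; rewrite mulr0 -size_poly_eq0 sP.
have szr : (size p1 + size r = 8)%N.
  have : size salem_poly = 7%N by rewrite sP.
  rewrite rE size_mul //; move: p10 r0; rewrite -!size_poly_eq0.
  by clear; move: (size p1) (size r) => [|i] [|j] // _ _; rewrite addnS /= => ->.
have rx : root (map_poly (intr : int -> R) r) x^-1.
  have : root (map_poly (intr : int -> R) salem_poly) x^-1.
    by apply/rootP; rewrite -map_ratr_intr horner_salem salem_fun_inv.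
  by rewrite rE rmorphM rootM (negbTE np1x).
have small : (size p1 <= 4)%N.
  pose rr : {poly rat} := map_poly intr r.
  have szrr : size rr = size r by rewrite size_map_inj_poly //; exact: intr_inj.
  pose r' : {poly rat} := \poly_(i < size rr) rr`_((size rr).-1 - i).
  have rr0 : rr != 0 by rewrite -size_poly_eq0 szrr size_poly_eq0.
  have r'0 : r' != 0.
    apply: contra_neq rr0 => e; have := congr1 (fun s : {poly rat} => s`_0) e.
    rewrite coef_poly coef0 subn0 size_poly_gt0; case: eqP => // _ /= /eqP.
    by rewrite -/(lead_coef rr) lead_coef_eq0 => /eqP.
  have r'x : root (map_poly ratr r') x.
    have := @horner_rev _ (map_poly (ratr : rat -> R) rr) x xn0.
    rewrite size_map_poly => h; apply/rootP.
    have -> : map_poly ratr r' =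
        \poly_(i < size rr) (map_poly (ratr : rat -> R) rr)`_((size rr).-1 - i).
      apply/polyP => i; rewrite coef_map /= [RHS]coef_poly coef_poly.
      by case: ifP => _; [rewrite [RHS]coef_map|rewrite rmorph0].
    apply: (etrans h); apply/eqP; rewrite mulf_eq0; apply/orP; right.
    by rewrite -[_ == 0]/(root _ _) map_ratr_intr.
  have := pmin _ r'0 r'x; rewrite szp => h.
  have := leq_trans h (size_poly _ _); rewrite szrr; move: szr; clear.
  by move: (size p1) (size r) => i j; lia.
have coefE k : (salem_poly : seq int)`_k = \sum_(j < k.+1) p1`_j * r`_(k - j) by rewrite rE coefM.
rewrite sP in coefE.
have nz (s : {poly int}) k : (size s <= k)%N -> s`_k = 0 by exact: nth_default.
have h0 := coefE 0%N; have h1 := coefE 1%N; have h2 := coefE 2%N; have h3 := coefE 3%N.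
have h4 := coefE 4%N; have h5 := coefE 5%N; have h6 := coefE 6%N.
move: h0 h1 h2 h3 h4 h5 h6.
rewrite !big_ord_recl !big_ord0 /= /bump /= !subn0 !addn0 !add1n !subSS !subn0 !addr0.
rewrite (nz p1 4%N) // (nz p1 5%N) ?(nz p1 6%N) ?(leq_trans small) // !mul0r !addr0.
have sz1 : (1 < size p1)%N by rewrite -szp; case: irr.
have p1E y : (map_poly (intr : int -> R) p1).[y] =
    (p1`_0)%:~R + (p1`_1)%:~R * y + (p1`_2)%:~R * y ^+ 2 + (p1`_3)%:~R * y ^+ 3.
  rewrite (@horner_coef_wide _ 4); last by rewrite (leq_trans (size_poly _ _)).
  by rewrite !big_ord_recl big_ord0 !coef_map /= /bump /=; ring.
move: p1x np1x; rewrite /root !p1E.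
have xg : x ^+ 2 < x + 1 by nra.
(* A quadratic factor [a0 + a1 * t + a2 * t ^ 2] has units [a0] and [a2].  If
   they are equal it is reciprocal; otherwise [a1] is, up to sign, [x - x^-1],
   which lies strictly between 0 and 1. *)
have noint (m : int) : ~ (0 < m%:~R :> R /\ m%:~R < 1 :> R).
  by rewrite ltr0z ltrz1 => -[]; clear; lia.
have [s4|[s3|s2]] : size p1 = 4%N \/ size p1 = 3%N \/ size p1 = 2%N.
  by move: sz1 small; clear; move: (size p1) => i; lia.
- have sr : size r = 4%N by move: szr; rewrite s4; clear; move: (size r) => i; lia.
  rewrite (nz r 4%N) ?(nz r 5%N) ?(nz r 6%N) ?sr // !mulr0 !add0r => _ _ e0 e1 e2 e3 e4 e5 e6.
  apply: (@no_cubic_factors p1`_0 p1`_1 p1`_2 p1`_3 r`_0 r`_1 r`_2 r`_3).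
  + by rewrite -e0.
  + by rewrite e1; ring.
  + by rewrite e2; ring.
  + by rewrite e3; ring.
  + by rewrite e4; ring.
  + by rewrite e5; ring.
  + by rewrite -e6.
- have sr : size r = 5%N by move: szr; rewrite s3; clear; move: (size r) => i; lia.
  rewrite (nz p1 3%N) ?(nz r 5%N) ?(nz r 6%N) ?s3 ?sr // !mulr0 !mul0r !add0r !addr0.
  move=> /eqP px' npx' e0 _ _ _ _ _ e6; move: px' npx'.
  have [[a0 _]|[a0 _]] := unit_int (esym e0); have [[a2 _]|[a2 _]] := unit_int (esym e6);
    rewrite a0 a2 ?rmorphN1 ?rmorph1 ?mulN1r ?mul1r => px' npx'.
  + move/eqP: npx'; apply; apply: (mulfI (expf_neq0 2 xn0)); rewrite mulr0 -px'; field.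
    by [].
  + by apply: (noint p1`_1); split; nra.
  + by apply: (noint (- p1`_1)); rewrite rmorphN; split; nra.
  + move/eqP: npx'; apply; apply: (mulfI (expf_neq0 2 xn0)); rewrite mulr0 -px'; field.
    by [].
- have sr : size r = 6%N by move: szr; rewrite s2; clear; move: (size r) => i; lia.
  rewrite (nz p1 2%N) ?(nz p1 3%N) ?(nz r 6%N) ?s2 ?sr // !mulr0 !mul0r !add0r !addr0.
  move=> /eqP px' _ e0 _ _ _ _ _ e6; move: px'.
  have [[a0 _]|[a0 _]] := unit_int (esym e0); have [[a1 _]|[a1 _]] := unit_int (esym e6);
    by rewrite a0 a1 ?rmorphN1 ?rmorph1 ?mulN1r ?mul1r => px'; lra.
Qed.

(** * Tent maps *)

Definition tent (R : realType) (l x : R) : R := 1 - l * `|x|.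

Section Tent.
Variables (R : realType) (l : R).
Hypothesis l12 : 1 < l <= 2.

Lemma tent_peaked : peaked (-1) 1 0 (tent l).
Proof.
have /andP[l1 l2] := l12; split.
- by rewrite ltrN10 ltr01.
- apply: continuous_subspaceT => x; rewrite /tent.
  apply: cvgB; first exact: cvg_cst.
  by apply: cvgM; [exact: cvg_cst|exact: (@norm_continuous _ R^o)].
- move=> x xI; have : 0 <= `|x| <= 1 by rewrite normr_ge0 ler_norml.
  by rewrite /tent; move: `|x| => u /andP[? ?]; apply/andP; split; nra.
- move=> x y; rewrite !in_itv /= => /andP[? ?] /andP[? ?] xy.
  by rewrite /tent !ler0_norm //; nra.
- move=> x y; rewrite !in_itv /= => /andP[? ?] /andP[? ?] xy.
  by rewrite /tent !ger0_norm //; nra.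
Qed.

Local Notation Q := (cuts (-1) 1 0 (tent l)).

Lemma tent_expansion n x y : -1 <= x <= 1 -> -1 <= y <= 1 -> x <= y ->
    no_cut (-1) 1 0 (tent l) n x y ->
  `|iter n (tent l) x - iter n (tent l) y| = l ^+ n * (y - x).
Proof.
have /andP[l1 l2] := l12.
elim: n x y => [|n IH] x y Ix Iy xy h.
  by rewrite expr0 mul1r /= distrC ger0_norm // subr_ge0.
rewrite !iterSr; have TI := peaked_itv tent_peaked.
have [[y0 h']|[x0 h']] := no_cutS tent_peaked Ix Iy xy h.
  have xyT : tent l x <= tent l y by rewrite /tent !ler0_norm; nra.
  rewrite (IH _ _ (TI _ Ix) (TI _ Iy) xyT h') exprSr -mulrA; congr (_ * _).
  by rewrite /tent !ler0_norm; lra.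
have yxT : tent l y <= tent l x by rewrite /tent !ger0_norm; nra.
rewrite distrC (IH _ _ (TI _ Iy) (TI _ Ix) yxT h') exprSr -mulrA; congr (_ * _).
by rewrite /tent !ger0_norm; lra.
Qed.

(** Each gap is stretched by [l ^+ n] inside an interval of length 2. *)
Lemma tent_cuts_ge n : l ^+ n <= ((size (Q n)).*2.+1)%:R.
Proof.
rewrite leNgt; apply/negP; set N := (_.+1)%N => hN.
have N0 : 0 < N%:R :> R by rewrite ltr0n.
pose x i : R := -1 + 2 * i%:R / N%:R.
have xI i : (i <= N)%N -> -1 <= x i <= 1.
  move=> iN; have : i%:R / N%:R <= 1 :> R by rewrite ler_pdivrMr // mul1r ler_nat.
  have : 0 <= i%:R / N%:R :> R by rewrite divr_ge0.
  by rewrite /x -mulrA; move: (_ / _) => u *; apply/andP; split; lra.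
have xS i : x i < x i.+1.
  by rewrite /x ltrD2l ltr_pM2r ?invr_gt0 // ltr_pM2l // ltr_nat.
have gapS i : (i < N)%N -> (gap (-1) 1 0 (tent l) n (x i) < gap (-1) 1 0 (tent l) n (x i.+1))%N.
  move=> iN; rewrite ltn_neqAle; apply/andP; split; last first.
    by rewrite /gap leq_add //; apply: sub_count => q /=;
      [move=> h; apply: lt_trans (xS i)|move=> h; apply: le_trans (ltW (xS i))].
  apply/eqP => e; have nc := gap_eq e (xS i).
  have := tent_expansion (xI _ (ltnW iN)) (xI _ iN) (ltW (xS i)) nc.
  have -> : x i.+1 - x i = 2 / N%:R by rewrite /x -[i.+1%:R]natr1; field; rewrite gt_eqF.
  have := peaked_iter tent_peaked n (xI _ (ltnW iN)).
  have := peaked_iter tent_peaked n (xI _ iN).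
  move=> /andP[? ?] /andP[? ?] e2.
  have : l ^+ n * (2 / N%:R) <= 2.
    by rewrite -e2 ler_norml; apply/andP; split; lra.
  rewrite mulrCA ger_pMr // ler_pdivrMr // mul1r.
  by rewrite leNgt hN.
have : (N <= gap (-1) 1 0 (tent l) n (x N))%N.
  have key i : (i <= N)%N -> (i <= gap (-1) 1 0 (tent l) n (x i))%N.
    elim: i => // i IH iN; exact: leq_ltn_trans (IH (ltnW iN)) (gapS i iN).
  exact: key.
by rewrite leqNgt gap_bound.
Qed.

(** Bounding the growth rate below by any [mu] between 1 and [l] is enough, since
    [kneading_root] then makes it a root of an explicit polynomial. *)
Lemma tent_entropy : exists2 lam : R, 1 < lam & lam%:E = expeR (h_top `[-1, 1] (tent l)).
Proof.
have /andP[l1 l2] := l12.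
have hub := h_top_le_cuts tent_peaked (ltn0Sn 0).
have hpos : (0 < h_top `[(-1)%R, 1%R] (tent l))%E.
  rewrite ltNge; apply/negP => h0.
  pose mu := (1 + l) / 2.
  have mu1 : 1 < mu by rewrite /mu; lra.
  have mu0 : 0 < mu by lra.
  have [|C [N hN]] := cuts_growth_le tent_peaked mu1.
    by apply: (le_lt_trans h0); rewrite lte_fin ln_gt0.
  pose x := l / mu - 1.
  have x0 : 0 < x by rewrite /x subr_gt0 ltr_pdivlMr // mul1r /mu; lra.
  have lx : l = mu * (1 + x) by rewrite /x addrC subrK mulrC divfK // gt_eqF.
  have bound n : (N <= n)%N -> n%:R <= (2 * C) / x.
    move=> Nn; rewrite ler_pdivlMr //.
    have := tent_cuts_ge n; rewrite -natr1 -mul2n natrM [X in X ^+ _]lx exprMn => h.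
    have mun : 1 <= mu ^+ n by rewrite exprn_ege1 // ltW.
    have h2 := hN n Nn; have h3 := bernoulli n (ltW x0).
    have mun0 : 0 < mu ^+ n by lra.
    rewrite -(ler_pM2l mun0).
    have {}h3 : mu ^+ n + mu ^+ n * (n%:R * x) <= mu ^+ n * (1 + x) ^+ n.
      by rewrite -[X in X + _]mulr1 -mulrDr ler_pM2l.
    rewrite [mu ^+ n * (2 * C)](_ : _ = 2 * (C * mu ^+ n)); last by ring.
    move: mun h h2 h3; move: (mu ^+ n * (n%:R * x)) (mu ^+ n * (1 + x) ^+ n) (C * mu ^+ n).
    by move: (mu ^+ n) => *; lra.
  have M0 : 0 <= 2 * C / x by apply: le_trans (bound N (leqnn N)).
  have /truncn_itv/andP[_ hM] := M0.
  have := bound (maxn N (Num.truncn (2 * C / x)).+1) (leq_maxl _ _).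
  apply/negP; rewrite -ltNge; apply: (lt_le_trans hM).
  by rewrite ler_nat leq_maxr.
move: hub hpos; case: (h_top _ _) => [r| |] // _; rewrite lte_fin => r0.
by exists (expR r) => //; rewrite expR_gt1.
Qed.

End Tent.

Section Salem.
Variable R : realType.

Lemma salem_fun_pos (x : R) : 8 / 5 <= x -> 0 < salem_fun x.
Proof.
move=> hx; pose h := (x - 1) ^+ 2 * (x + 1).
have -> : salem_fun x = x ^+ 2 * (x * h) - x ^+ 2 - x + 1 by rewrite /salem_fun /h; ring.
have h1 : 9 / 10 <= h.
  have : 9 / 25 <= (x - 1) ^+ 2 by nra.
  by rewrite /h; move: (_ ^+ 2) => u ?; nra.
have h2 : 36 / 25 <= x * h by move: (h) h1 => v ?; nra.
have : x ^+ 2 * (36 / 25) <= x ^+ 2 * (x * h) by apply: ler_wpM2l; rewrite ?exprn_ge0; lra.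
by move: (x ^+ 2 * (x * h)) => v ?; nra.
Qed.

Lemma salem_fun_neg (x : R) : 1 < x -> x <= 3 / 2 -> salem_fun x < 0.
Proof.
move=> x1 x2; have xn0 : x != 0 by rewrite gt_eqF; lra.
pose w := x + x^-1.
have xx : x * x^-1 = 1 by rewrite mulfV.
have xi : x^-1 = w - x by rewrite /w; lra.
(* As a reciprocal polynomial, it is a cubic in [w = x + x^-1]. *)
have -> : salem_fun x = x ^+ 3 * (w ^+ 3 - w ^+ 2 - 4 * w + 3).
  by rewrite /salem_fun /w; field.
have w2 : 2 <= w by nra.
have w3 : w <= 13 / 6.
  rewrite xi in xx.
  nra.
have x3 : 0 < x ^+ 3 by rewrite exprn_gt0; lra.
rewrite pmulr_rlt0 //.
nra.
Qed.

End Salem.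

(** * The teapot is not symmetric *)

Section Witness.
Variable R : realType.

Lemma salem_slope : exists2 l : R, 31 / 20 <= l <= 39 / 25 & salem_fun l = 0.
Proof.
pose p : {poly R} := map_poly ratr (map_poly intr salem_poly : {poly rat}).
have pE x : p.[x] = salem_fun x by exact: horner_salem.
have [|l hl /rootP] := @poly_ivt R p (31 / 20) (39 / 25) ltac:(lra).
  by rewrite !pE /salem_fun; apply/andP; split; lra.
by rewrite pE; exists l.
Qed.

(** The itinerary C R L R R L R: the interval for [l] is short enough to decide
    the side of every point by rational bounds, and the last equation is then the
    polynomial one. *)
Lemma salem_tent (l : R) : 31 / 20 <= l <= 39 / 25 -> salem_fun l = 0 ->
  iter 7 (tent l) 0 = 0 /\
  forall k, (k < 7)%N -> (iter k (tent l) 0 < 0) = (k == 2%N) || (k == 5%N).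
Proof.
move=> /andP[l1 l2] sl.
pose y k := iter k (tent l) 0.
have yS k : y k.+1 = 1 - l * `|y k| by [].
have pos k : 0 <= y k -> y k.+1 = 1 - l * y k by move=> h; rewrite yS ger0_norm.
have neg k : y k < 0 -> y k.+1 = 1 + l * y k by move=> h; rewrite yS ltr0_norm // mulrN opprK.
have y0 : y 0%N = 0 by [].
have y1 : y 1%N = 1 by rewrite pos ?y0 // mulr0 subr0.
have y2 : y 2%N = 1 - l by rewrite pos y1 // mulr1.
have y2n : y 2%N < 0 by rewrite y2; lra.
have y3 : 126 / 1000 <= y 3%N <= 148 / 1000.
  by rewrite neg // y2; apply/andP; split; nra.
have y3p : 0 <= y 3%N by case/andP: y3 => *; lra.
have y4 : 76 / 100 <= y 4%N <= 81 / 100.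
  by rewrite pos //; move: (y 3%N) y3 => u /andP[? ?]; apply/andP; split; nra.
have y4p : 0 <= y 4%N by case/andP: y4 => *; lra.
have y5 : - (27 / 100) <= y 5%N <= - (17 / 100).
  by rewrite pos //; move: (y 4%N) y4 => u /andP[? ?]; apply/andP; split; nra.
have y5n : y 5%N < 0 by case/andP: y5 => *; lra.
have y6p : 0 <= y 6%N.
  by rewrite neg //; move: (y 5%N) y5 => u /andP[? ?]; nra.
split.
  rewrite -/(y 7%N) pos // (neg 5%N) // (pos 4%N) // (pos 3%N) // (neg 2%N) // y2 -[RHS]sl.
  by rewrite /salem_fun; ring.
move=> k k7; rewrite -/(y k).
case: k k7 => [|[|[|[|[|[|[|//]]]]]]] _.
- by rewrite y0 ltxx.
- by rewrite y1 ltr10.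
- by rewrite y2n.
- by rewrite ltNge y3p.
- by rewrite ltNge y4p.
- by rewrite y5n.
- by rewrite ltNge y6p.
Qed.

Lemma salem_kneading (F : nzRingType) (x : F) (e : nat -> bool) :
    (forall k, (k < 7)%N -> e k = (k == 2%N) || (k == 5%N)) ->
  kneading_orbit x e 7 = salem_fun x.
Proof.
move=> he; rewrite /= !he //= /salem_fun !expr0 expr1 !mulN1r !mul1r !mulr0 subr0 mulr1.
rewrite !opprK !exprS expr0 mulr1 !(mulrBr, mulrDr) !mulr1 !opprD !opprK !addrA.
by rewrite ?mulrN ?mulNr ?opprK.
Qed.

(** The growth rate [x] of the tent map is a root of [salem_fun] greater than 1,
    and all such roots lie between [3 / 2] and [8 / 5]. *)
Lemma witness : exists2 x : R, 3 / 2 < x < 8 / 5 &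
  teapot_pairs ((x^-1)%:C%C : Cplx R, x).
Proof.
have [l lb sl] := salem_slope; have [T7 Tsgn] := salem_tent lb sl.
have l12 : 1 < l <= 2 by case/andP: lb => *; apply/andP; split; lra.
have pf := tent_peaked l12.
have [x x1 xE] := tent_entropy l12.
have [h _] := kneading_root pf T7 x1 xE.
rewrite (salem_kneading _ Tsgn) in h.
have xI : 3 / 2 < x < 8 / 5.
  apply/andP; split; rewrite ltNge; apply/negP => hx.
    by have := salem_fun_neg x1 hx; rewrite h ltxx.
  by have := salem_fun_pos hx; rewrite h ltxx.
exists x => //; split; last exact: inverse_conjugate.
exists (-1), 1, 0, (tent l); split=> //; last by exists 7%N.
by case: pf => *; split=> //; left.
Qed.

End Witness.

Lemma closure_teapot_near (R : realType) (z : Cplx R) (l d : R) : 0 < d ->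
    master_teapot (z, l) ->
  exists z' l', [/\ teapot_pairs (z' : Cplx R, l'), `|z - z'| < d%:C%C & `|l - l'| < d].
Proof.
move=> d0 /(_ [set w | `|z - w.1| < d%:C%C /\ `|l - w.2| < d]) [|[z' l'] [h [h1 h2]]]; last first.
  by exists z', l'.
exists ([set w : Cplx R | `|z - w| < d%:C%C], [set r | `|l - r| < d]); last by move=> [u v] [].
have d0' : 0 < (d%:C%C : Cplx R) by rewrite ltcR.
by split=> /=; [have := nbhsx_ballx z _ d0'|have := nbhsx_ballx l _ d0]; rewrite -ball_normE.
Qed.

Lemma normc_real_part (R : realType) (z : Cplx R) : exists t : R, `|z| = (t%:C%C : Cplx R).
Proof. by exists (complex.Re `|z|); rewrite RRe_real // normr_real. Qed.

Theorem theorem3 (R : realType) :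
  ~ (@reflection R @` (@master_teapot R `&` @unit_cylinder R)
       `<=` @master_teapot R `&` @unit_cylinder R).
Proof.
move=> sub; have [x /andP[x1 x2] tp] := witness R.
pose w := x^-1; have x0 : 0 < x by lra.
have wx : w * x = 1 by rewrite /w mulVf // gt_eqF.
have w1 : 5 / 8 <= w by nra.
have w2 : w <= 2 / 3 by nra.
have wn : `|w%:C%C : Cplx R| = w%:C%C.
  by rewrite ger0_norm // (lecR 0); lra.
have [] : (@master_teapot R `&` @unit_cylinder R) (reflection ((w%:C%C : Cplx R), x)).
  apply: sub; exists ((w%:C%C : Cplx R), x) => //; split; first exact: subset_closure.
  split; first by rewrite /= wn (lecR _ 1); lra.
  by rewrite /=; apply/andP; split; lra.
rewrite /reflection /= => /(@closure_teapot_near R _ _ (1 / 100) ltac:(lra)).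
move=> [z [l [zl hz hl]]] _.
have [t tE] := normc_real_part z; have [s sE] := normc_real_part (1 - z).
have tw : t <= w + 1 / 100.
  have : `|z| <= `|w%:C%C : Cplx R| + `|- w%:C%C - z|.
    have e : - z = w%:C%C + (- w%:C%C - z) by rewrite addrA subrr add0r.
    by rewrite -[X in X <= _]normrN {1}e; exact: ler_normD.
  rewrite wn tE -lecR (rmorphD (real_complex R)) /= => /le_trans; apply.
  by rewrite lerD2l; exact: ltW.
have sw : 1 + w <= s + 1 / 100.
  rewrite -lecR !(rmorphD (real_complex R)) /= -sE.
  have e : 1 + w%:C%C = (1 - z) - (- w%:C%C - z) by rewrite opprB opprK addrA subrK.
  have : `|1 + w%:C%C : Cplx R| <= `|1 - z| + `|- w%:C%C - z| by rewrite e; exact: ler_normB.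
  rewrite (ger0_norm (_ : 0 <= 1 + w%:C%C)); last by rewrite -[1]/(1%:C%C) -rmorphD (lecR 0) /=; lra.
  by move=> /le_trans; apply; rewrite lerD2l; exact: ltW.
move: hl; rewrite ltr_norml => /andP[l1 l2].
have t1 : `|z| < 1 by rewrite tE (ltcR _ 1); lra.
have := conjugate_region zl; move=> /(_ ltac:(lra) ltac:(nra) t1).
rewrite tE sE -[1]/(1%:C%C) -rmorphB -rmorphM -rmorphXn lecR.
have t0 : 0 <= t by rewrite -(lecR 0) -tE; exact: normr_ge0.
by nra.
Qed.
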